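(* Let $k\ge 1$ be an integer and $n=2k$. Let $E_4(n)$ (respectively $O_4(n)$) be the set of partitions $\alpha=(\alpha_1\ge\alpha_2\ge\alpha_3\ge\alpha_4\ge 0)$ of $n$ such that all four of $\alpha_1,\alpha_2,\alpha_3,\alpha_4$ are even (respectively all four are odd), where $0$ counts as even. Then $$S^2([k,k])=\sum_{\alpha\in E_4(n)}[\alpha],\qquad A^2([k,k])=\sum_{\alpha\in O_4(n)}[\alpha].$$ Moreover, for a partition $\alpha$ of $n$ put $s(\alpha)=1$ if $\alpha\in E_4(n)$, $s(\alpha)=-1$ if $\alpha\in O_4(n)$, and $s(\alpha)=0$ otherwise. Then the $k$-th Catalan number $C_k=\frac{1}{k+1}\binom{2k}{k}$ satisfies $$C_k=\sum_{\alpha\vdash 2k}s(\alpha)\,f(\alpha).$$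
   Context: For a partition $\lambda$ of $n$, $[\lambda]$ denotes the irreducible complex character of the symmetric group $S_n$ labelled by $\lambda$, and $f(\lambda)=[\lambda](\mathrm{id})$ is its degree, i.e. the number of standard Young tableaux of shape $\lambda$. For a character $\chi$ of a finite group, $S^2(\chi)(g)=\tfrac12(\chi(g)^2+\chi(g^2))$ and $A^2(\chi)(g)=\tfrac12(\chi(g)^2-\chi(g^2))$ are the symmetric and anti-symmetric parts of $\chi^2$. *)

(* Defs.v *)
From HB Require Import structures.
From mathcomp Require Import all_boot all_order all_algebra all_fingroup.
From mathcomp Require Import all_solvable all_field all_character.
Set Implicit Arguments.
Unset Strict Implicit.
Unset Printing Implicit Defensive.
Import GroupScope GRing.Theory.
Local Open Scope ring_scope.

Section SquareParts.

Variables (gT : finGroupType) (G : {group gT}).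
Implicit Type chi : 'CF(G).

Fact cf_at_square_subproof chi :
  is_class_fun <<G>> [ffun g => (g \in G)%:R * chi (g ^+ 2)%g].
Proof.
rewrite genGid; apply: intro_class_fun => [x y Gx Gy | x /negbTE->].
  by rewrite groupJr // -conjXg cfunJ.
by rewrite mul0r.
Qed.

(* g |-> chi (g ^ 2) on G; class functions vanish outside G. *)
Definition cf_at_square chi : 'CF(G) := Cfun 0 (cf_at_square_subproof chi).

Definition cfSym2 chi : 'CF(G) := 2%:R^-1 *: (chi ^+ 2 + cf_at_square chi).
Definition cfAlt2 chi : 'CF(G) := 2%:R^-1 *: (chi ^+ 2 - cf_at_square chi).

Lemma cfSym2E chi g : g \in G ->
  cfSym2 chi g = 2%:R^-1 * (chi g ^+ 2 + chi (g ^+ 2)%g).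
Proof. by move=> Gg; rewrite !cfunE Gg mul1r. Qed.

Lemma cfAlt2E chi g : g \in G ->
  cfAlt2 chi g = 2%:R^-1 * (chi g ^+ 2 - chi (g ^+ 2)%g).
Proof. by move=> Gg; rewrite !cfunE Gg mul1r. Qed.

End SquareParts.

Definition is_intpart (n : nat) (s : seq nat) : bool :=
  [&& sorted geq s, 0%N \notin s & sumn s == n].

(* The parts are positive, so nth 0 a i is the (i + 1)-st part of a,
   read as 0 beyond the length of a. *)
Record intpart (n : nat) : Type :=
  IntPart { parts :> seq nat; _ : is_intpart n parts }.

HB.instance Definition _ n := [isSub for @parts n].
HB.instance Definition _ n := [Countable of intpart n by <:].

Section IntPartFinite.

Variable n : nat.

Definition intpart_code (a : intpart n) : {ffun 'I_n -> 'I_n.+1} :=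
  [ffun i : 'I_n => inord (nth 0%N a i)].

Definition intpart_decode (f : {ffun 'I_n -> 'I_n.+1}) : option (intpart n) :=
  insub [seq m <- [seq (f i : nat) | i <- enum 'I_n] | m != 0%N].

Lemma intpart_codeK : pcancel intpart_code intpart_decode.
Proof.
move=> a; rewrite /intpart_decode -[RHS](valK a); congr insub.
case: a => s /= sP; have /and3P[_ nz_s /eqP sum_s] := sP.
have le_part i : (nth 0 s i <= n)%N.
  case: (ltnP i (size s)) => [lt_i|ge_i]; last by rewrite nth_default.
  by rewrite -sum_s -(cat_take_drop i s) (drop_nth 0%N) // sumn_cat /= addnCA
             nth_cat size_take lt_i ltnn subnn /= leq_addr.
have size_s : (size s <= n)%N.
  rewrite -sum_s; elim: s nz_s {sP sum_s le_part} => //= m s IHs.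
  rewrite inE negb_or eq_sym -lt0n => /andP[m_gt0 /IHs le_s].
  by rewrite -add1n leq_add.
have -> : [seq (intpart_code (IntPart sP) i : nat) | i <- enum 'I_n]
          = [seq nth 0%N s i | i <- iota 0 n].
  rewrite -val_enum_ord -map_comp; apply: eq_map => i /=.
  by rewrite ffunE inordK // ltnS le_part.
rewrite -(subnKC size_s) iotaD map_cat filter_cat add0n.
rewrite -/(mkseq (nth 0%N s) (size s)) mkseq_nth.
rewrite (eq_in_filter (a2 := pred0) (s := map _ _)); last first.
  move=> m /mapP[i]; rewrite mem_iota => /andP[le_i _] ->.
  by rewrite nth_default.
rewrite filter_pred0 cats0; apply/all_filterP/allP => m s_m.
by apply: contraNneq nz_s => <-.
Qed.

HB.instance Definition _ : isFinite (intpart n) := PCanIsFinite intpart_codeK.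

End IntPartFinite.

Fact two_equal_parts_subproof k : (0 < k)%N -> is_intpart (2 * k)%N [:: k; k].
Proof.
move=> k_gt0.
by rewrite /is_intpart /= leqnn !inE eq_sym eqn0Ngt k_gt0 addn0 addnn mul2n /=.
Qed.

Definition two_equal_parts k (k_gt0 : (0 < k)%N) : intpart (2 * k)%N :=
  IntPart (two_equal_parts_subproof k_gt0).

Section IrrSym.

Variable n : nat.

Local Notation SymG := [set: 'S_n]%G.

Section LevelStab.

Variables (T : eqType) (c : 'I_n -> T).

Definition level_stab : {set 'S_n} := [set s : 'S_n | [forall i, c (s i) == c i]].

Lemma level_stab_group_set : group_set level_stab.
Proof.
apply/group_setP; split=> [|s t]; first by rewrite inE; apply/forallP=> i; rewrite perm1.
rewrite !inE => /forallP cs /forallP ct; apply/forallP=> i.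
by rewrite permM (eqP (ct _)) (eqP (cs _)).
Qed.

Canonical level_stab_group := Group level_stab_group_set.

End LevelStab.

Fact cfSign_subproof : is_class_fun <<SymG>> [ffun s : 'S_n => (-1) ^+ odd_perm s].
Proof.
rewrite genGid; apply: intro_class_fun => [s t _ _ | s]; last by rewrite inE.
by rewrite odd_permJ.
Qed.

Definition cfSign : 'CF(SymG) := Cfun 0 (cfSign_subproof).

(* Cells of the Young diagram of a are numbered 0, ..., n - 1 row by row, so
   that cell i lies in row reshape_index a i and column reshape_offset a i. *)
Definition row_stab (a : intpart n) : {group 'S_n} :=
  level_stab_group (fun i : 'I_n => reshape_index a i).
Definition col_stab (a : intpart n) : {group 'S_n} :=
  level_stab_group (fun i : 'I_n => reshape_offset a i).

(* The standard labelling of the irreducible characters of the symmetric group: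
   [a] is the one irreducible constituent that the trivial character of the row
   stabilizer and the sign character of the column stabilizer, both induced to
   'S_n, have in common. A common constituent exists and is unique, so the
   default index 0 is never reached. *)
Definition irr_sym_index (a : intpart n) : Iirr SymG :=
  odflt 0 [pick i | i \in irr_constt ('Ind[SymG, row_stab a] 1)
                  & i \in irr_constt ('Ind[SymG] ('Res[col_stab a] cfSign))].

Definition irr_sym (a : intpart n) : 'CF(SymG) := 'chi_(irr_sym_index a).

Definition deg_sym (a : intpart n) : algC := irr_sym a 1%g.

Definition E4 : {set intpart n} :=
  [set a : intpart n |
    (size a <= 4)%N && [forall i : 'I_4, ~~ odd (nth 0%N a i)]].
Definition O4 : {set intpart n} :=
  [set a : intpart n |
    (size a <= 4)%N && [forall i : 'I_4, odd (nth 0%N a i)]].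

Definition sgn4 (a : intpart n) : int :=
  if a \in E4 then 1 else if a \in O4 then -1 else 0.

End IrrSym.

Arguments E4 n : clear implicits.
Arguments O4 n : clear implicits.

(* Main.v *)
Require Import Defs.
From mathcomp Require Import all_boot all_order all_algebra all_fingroup.
From mathcomp Require Import all_solvable all_field all_character.
From mathcomp Require Import ring zify.
Set Implicit Arguments.
Unset Strict Implicit.
Unset Printing Implicit Defensive.
Import Order.TTheory GRing.Theory Num.Theory GroupScope.
Local Open Scope ring_scope.

(** Let V = C^2. By Schur-Weyl duality the character [k, k] is afforded by the
    SL_2-invariants of the 2k-th tensor power of V, so its square is afforded by
    the invariants of SL_2 x SL_2, that is of SO_4, in the 2k-th tensor power of
    V (x) V = C^4, and exchanging the two factors V acts as a reflection of O_4.
    The Schur functor S_a(C^4) has a one-dimensional space of O_4-invariants when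
    all four parts of a are even, a one-dimensional space of det-semi-invariants
    when they are all odd, and neither otherwise. Hence the symmetric square is
    the sum over E4 and the alternating square the sum over O4.

    The proof carries out this computation on character values. The analytic
    tools are replaced by sums over the colorings c of the n points that are
    fixed by a permutation g; the sum of the corresponding monomials is the power
    sum product p_g(x), with one variable per color.

    - The Frobenius formula, [irr_sym_jt]: for a partition a with at most m parts,
      the value of [a] at g is the coefficient of x^(a + delta) in a_delta(x) p_g(x),
      where delta = (m - 1, ..., 1, 0) and a_delta is the Vandermonde alternant. The
      class function so defined has norm 1, because by Pieri's rule its inner
      product with the permutation character on colorings of content nu vanishes
      unless a dominates nu; so it is irreducible up to sign, and its inner
      products with the two induced characters that define [a] are both 1.
    - Consequently, by [alternant_expansion], summing an alternating function kappa
      over the vectors content c + delta gives the sum of the kappa(a + delta) [a](g).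
    - There are two alternating functions on 4-vectors to which this applies. By
      Weyl's integration formula, they come from evaluating alternants on the
      torus elements (t, u, 1/u, 1/t) of SO_4 and (t, 1/t, 1, -1) of the other
      component of O_4, and dividing by the Weyl denominators; this leaves a
      Pfaffian in the first case and a polarized Pfaffian in the second. On
      a + delta the first is 2 on E4 and O4 and 0 elsewhere ([kernel_SO_part]);
      the second is 4 on E4, -4 on O4 and 0 elsewhere ([kernel_O_part]).
    - Summed over colorings, the first kernel is twice the square of [k, k](g),
      because a 4-coloring is a pair of 2-colorings ([sum_kernel_SO_square]). The
      second is four times [k, k](g^2), because the exchange of the factors of
      V (x) V has eigenvalues 1, 1, 1, -1, which yields the identity
      p_g(X^2, 1, X, -X) = p_(g^2)(X^2, 1) ([square_colorings]).

    The Catalan identity is the second relation at g = 1, with the degree of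
    [k, k] read off from [k, k] = h_k h_k - h_(k+1) h_(k-1). *)

(** * Alternants and the Pieri rule *)

Definition nat_vector (T : finType) N (mu : {ffun T -> 'I_N}) : {ffun T -> nat} :=
  [ffun t => mu t : nat].

Section Alternants.

Variable m : nat.
Implicit Types (beta mu a : {ffun 'I_m -> nat}) (v w : 'S_m).

(** The exponents m - 1, ..., 1, 0 of the Vandermonde alternant. *)
Definition stair (i : 'I_m) : nat := (m - i.+1)%N.

Definition addstair a : {ffun 'I_m -> nat} := [ffun i => a i + stair i]%N.

(** The coefficient of x^beta in x^mu times the Vandermonde alternant, that is the
    Jacobi-Trudi determinant of the shape beta - stair. As a determinant of 0-1
    entries it needs no subtraction of exponents. *)
Definition acoef beta mu : int :=
  \det (\matrix_(i < m, j < m) (beta i == mu i + stair j)%N%:R).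

Definition strict_decr (beta : 'I_m -> nat) :=
  forall i j : 'I_m, (i < j)%N -> (beta j < beta i)%N.

Lemma acoefE beta mu :
  acoef beta mu = \sum_w (-1) ^+ odd_perm w * [forall i, beta i == mu i + stair (w i)]%N%:R.
Proof.
apply: eq_bigr => w _; congr (_ * _).
case: eqfunP => [E | /eqfunP]; first by rewrite big1 // => i _; rewrite mxE E eqxx.
rewrite negb_forall => /existsP[i /negPf Ei].
by rewrite (bigD1 i) //= mxE Ei mul0r.
Qed.

Lemma acoef_perm beta mu v :
  acoef [ffun i => beta (v i)] [ffun i => mu (v i)] = (-1) ^+ odd_perm v * acoef beta mu.
Proof.
rewrite /acoef -det_perm -det_mulmx -row_permE; congr (\det _).
by apply/matrixP=> i j; rewrite !mxE !ffunE.
Qed.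

Lemma strict_decr_ge_stair beta : strict_decr beta -> forall i, (stair i <= beta i)%N.
Proof.
move=> decr; suff H d : forall i : 'I_m, stair i = d -> (d <= beta i)%N by move=> i; apply: H.
elim: d => // d IHd i; rewrite /stair => Ei.
have lt_i : (i.+1 < m)%N by lia.
apply: leq_ltn_trans (decr i (Ordinal lt_i) _) => //.
by apply: IHd; rewrite /stair /=; lia.
Qed.

(** The identity is the only arrangement of the decreasing sequence stair whose
    partial sums reach the maximal ones: if w fixes all j < i then w i >= i by
    injectivity, and the hypothesis for r = i + 1 gives w i <= i. *)
Lemma perm_partial_sums w :
  (forall r, (r <= m)%N ->
     (\sum_(i < m | i < r) stair i <= \sum_(i < m | i < r) stair (w i))%N) ->
  w = 1%g.
Proof.
move=> le_sum; suff H d : forall i : 'I_m, (i < d)%N -> w i = i.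
  by apply/permP=> i; rewrite perm1 (H m).
elim: d => // d IHd i; rewrite ltnS leq_eqVlt => /orP[/eqP id|]; last exact: IHd.
have := le_sum i.+1 (ltn_ord i).
rewrite !(bigD1 (P := fun j : 'I_m => (j < i.+1)%N) i) //=.
rewrite [X in (_ + X <= _)%N](eq_bigr (fun j => stair (w j))); last first.
  move=> j /andP[ltj nji]; rewrite IHd //.
  by rewrite -id ltn_neqAle nji -ltnS.
rewrite leq_add2r /stair => le_wi; apply/val_inj/eqP; rewrite eqn_leq /=.
have -> : (w i <= i)%N by have:= ltn_ord i; have:= ltn_ord (w i); lia.
rewrite leqNgt; apply/negP=> lt_wi.
have := IHd (w i); rewrite -id => /(_ lt_wi) /perm_inj E.
by rewrite E ltnn in lt_wi.
Qed.

(** A nonzero term w of the Leibniz expansion has mu + stair o w = a + stair, so the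
    partial sums of stair o w are at least those of stair, which forces w = 1. *)
Lemma acoef_dominated a mu :
  (forall r, (r <= m)%N ->
     (\sum_(i < m | i < r) mu i <= \sum_(i < m | i < r) a i)%N) ->
  acoef (addstair a) mu = (mu == a)%:R.
Proof.
move=> dom; rewrite acoefE (bigD1 1%g) //= odd_perm1 mul1r big1 ?addr0 => [|w w1].
  congr (_%:R : int); congr nat_of_bool; apply/eqfunP/eqP => [E | -> i].
    by apply/ffunP=> i; have := E i; rewrite ffunE perm1 => /addIn.
  by rewrite ffunE perm1.
case: eqfunP => [E|]; rewrite ?mulr0 //; case/eqP: w1.
apply: perm_partial_sums => r /dom; rewrite -(leq_add2r (\sum_(i < m | i < r) stair i)%N).
have -> : (\sum_(i < m | i < r) a i + \sum_(i < m | i < r) stair i =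
           \sum_(i < m | i < r) mu i + \sum_(i < m | i < r) stair (w i))%N.
  by rewrite -!big_split /=; apply: eq_bigr => i _; rewrite -E ffunE.
by rewrite leq_add2l.
Qed.

Lemma acoef_add beta mu gamma :
  acoef beta [ffun i => mu i + gamma i]%N =
  if [forall i, gamma i <= beta i]%N then acoef [ffun i => beta i - gamma i]%N mu else 0.
Proof.
case: forallP => [le_gb | /forallP].
  congr (\det _); apply/matrixP=> i j; rewrite !mxE !ffunE; congr (_%:R : int).
  by congr nat_of_bool; move: (le_gb i) => le_i; apply/idP/idP; lia.
rewrite negb_forall => /existsP[i lt_i].
rewrite /acoef (expand_det_row _ i) big1 // => j _.
by rewrite !mxE !ffunE (_ : (_ == _) = false) ?mul0r //; lia.
Qed.

Section Pieri.

Variable N : nat.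
Implicit Types (b k : {ffun 'I_m -> 'I_N}).

Definition antisym (f : {ffun 'I_m -> 'I_N} -> int) :=
  forall k v, f [ffun i => k (v i)] = (-1) ^+ odd_perm v * f k.

Definition below b k s := [forall i, k i <= b i]%N && (\sum_i k i == s)%N.

(** For k <= b and r = m this says that b - stair differs from k - stair by a horizontal
    strip. The bound r lets the conditions be imposed one index at a time. *)
Definition interlaced b k r :=
  [forall i : 'I_m, forall j : 'I_m, (i < r)%N && (j == i.+1 :> nat) ==> (b j < k i)%N].

Lemma interlacedE b k (i j : 'I_m) : interlaced b k m -> j = i.+1 :> nat -> (b j < k i)%N.
Proof.
move=> int_k ji; have /forallP/(_ j)/implyP := forallP int_k i.
by apply; rewrite ltn_ord ji eqxx.
Qed.

Lemma interlaced_decr b k : strict_decr (fun i => b i) -> (forall i, k i <= b i)%N ->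
  interlaced b k m -> strict_decr (fun i => k i).
Proof.
move=> decr le_k int_k i j lt_ij.
have lt_i : (i.+1 < m)%N := leq_ltn_trans lt_ij (ltn_ord j).
apply: leq_ltn_trans (interlacedE (j := Ordinal lt_i) int_k _) => //.
apply: leq_trans (le_k j) _; case: (ltngtP i.+1 j) => [lt|gt|eq].
- by apply/ltnW/decr.
- by have:= leq_trans gt lt_ij; rewrite ltnn.
- by rewrite (_ : Ordinal lt_i = j) //; apply: val_inj.
Qed.

(** The vectors k violating the condition at index r have both k r and k (r + 1)
    at most b (r + 1); exchanging these two entries preserves every other
    constraint and changes the sign of f, so these vectors contribute 0. *)
Lemma pieri (f : {ffun 'I_m -> 'I_N} -> int) b s r :
    antisym f -> strict_decr (fun i => b i) ->
  \sum_(k | below b k s) f k = \sum_(k | below b k s && interlaced b k r) f k.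
Proof.
move=> asf decr; elim: r => [|r ->].
  apply: eq_bigl => k; rewrite [interlaced _ _ _](_ : _ = true) ?andbT //.
  by apply/forallP=> i; apply/forallP.
case: (ltnP r.+1 m) => [lt_r | ge_r]; last first.
  apply: eq_bigl => k; congr (_ && _); apply: eq_forallb => i; apply: eq_forallb => j.
  by congr (_ ==> _); have lt_j := ltn_ord j; apply/idP/idP; lia.
pose i0 := Ordinal (ltnW lt_r); pose j0 := Ordinal lt_r.
rewrite (bigID (fun k => b j0 < k i0)%N) /= [X in _ + X](_ : _ = 0) ?addr0.
  apply: eq_bigl => k; rewrite -andbA; congr (_ && _).
  apply/andP/forallP => [[/forallP H lt] i | H].
    apply/forallP=> j; apply/implyP=> /andP[]; rewrite ltnS leq_eqVlt.
    case/orP=> [/eqP ir /eqP ji | ltir ji].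
      have -> : i = i0 by apply: val_inj.
      by have -> : j = j0 by apply: val_inj; rewrite /= ji ir.
    by move/forallP/(_ j)/implyP: (H i); apply; rewrite ltir.
  split; last by move/forallP/(_ j0)/implyP: (H i0); apply; rewrite /= leqnn eqxx.
  apply/forallP=> i; apply/forallP=> j; apply/implyP=> /andP[ltir ji].
  by move/forallP/(_ j)/implyP: (H i); apply; rewrite ltnS ltnW.
(* S is the sum over the vectors that violate the condition at index r. *)
set S := \sum_(_ | _) _; suff : S = - S by lia.
have ij0 : i0 != j0 by rewrite -val_eqE /= ltn_eqF.
have b_ij : (b j0 < b i0)%N by apply: decr.
pose t k : {ffun 'I_m -> 'I_N} := [ffun i => k (tperm i0 j0 i)].
have tK : involutive t by move=> k; apply/ffunP=> i; rewrite !ffunE tpermK.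
have tP k : below b k s && interlaced b k r && ~~ (b j0 < k i0)%N ->
    below b (t k) s && interlaced b (t k) r && ~~ (b j0 < t k i0)%N.
  case/andP=> /andP[/andP[/forallP le_k sum_k] /forallP int_k]; rewrite -!leqNgt => le_k0.
  rewrite -andbA; apply/and3P; split.
  - apply/andP; split; last first.
      rewrite -(eqP sum_k) [X in _ == X](reindex_inj (@perm_inj _ (tperm i0 j0))).
      by apply/eqP/eq_bigr => i _; rewrite ffunE.
    apply/forallP=> i; rewrite ffunE; case: tpermP => [->|->|_ _] //.
    by apply: leq_trans (le_k j0) (ltnW b_ij).
  - apply/forallP=> i; apply/forallP=> j; apply/implyP=> /andP[lt_i j_i].
    rewrite ffunE tpermD; last 2 first.
    + by rewrite -val_eqE /= eq_sym ltn_eqF.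
    + by rewrite -val_eqE /= eq_sym ltn_eqF // ltnW.
    by move/forallP/(_ j)/implyP: (int_k i); apply; rewrite lt_i.
  - by rewrite ffunE tpermL.
rewrite {1}/S (reindex_inj (inv_inj tK)) /S -sumrN.
apply: eq_big => [k | k _]; last by rewrite /t asf odd_tperm ij0 expr1 mulN1r.
by apply/idP/idP => [/tP|]; [rewrite tK | apply: tP].
Qed.

(** The coefficient of x^b in the Vandermonde alternant multiplied by the complete
    symmetric polynomials of degrees nu 0, ..., nu (p - 1), one factor at a time. *)
Fixpoint pieri_coef (nu : nat -> nat) p b : int :=
  if p is p'.+1
  then \sum_(k : {ffun 'I_m -> 'I_N} | [forall i, k i <= b i]%N &&
    (\sum_i k i + nu p' == \sum_i b i)%N)
         pieri_coef nu p' k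
  else acoef (nat_vector b) [ffun => 0%N].

Lemma pieri_coef_antisym nu p : antisym (pieri_coef nu p).
Proof.
elim: p => [|p IHp] b v /=.
  rewrite -acoef_perm; congr acoef; first by apply/ffunP=> i; rewrite !ffunE.
  by apply/ffunP=> i; rewrite !ffunE.
rewrite big_distrr /= (reindex (fun k : {ffun 'I_m -> 'I_N} => [ffun i => k (v i)]));
  last first.
  apply: onW_bij; exists (fun k : {ffun 'I_m -> 'I_N} => [ffun i => k ((v^-1)%g i)]) => k;
    by apply/ffunP=> i; rewrite !ffunE ?permK ?permKV.
apply: eq_big => [k | k _]; last exact: IHp.
have sumv (c : {ffun 'I_m -> 'I_N}) : (\sum_i [ffun i => c (v i)] i = \sum_i c i)%N.
  rewrite [RHS](reindex_inj (@perm_inj _ v)).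
  by apply: eq_bigr => i _; rewrite ffunE.
rewrite !sumv; congr (_ && _); apply/forallP/forallP => H i.
  by have:= H ((v^-1)%g i); rewrite !ffunE permKV.
by rewrite !ffunE.
Qed.

Lemma pieri_coefS nu p b : strict_decr (fun i => b i) ->
  pieri_coef nu p.+1 b =
  \sum_(k : {ffun 'I_m -> 'I_N} |
        [&& [forall i, k i <= b i]%N, (\sum_i k i + nu p == \sum_i b i)%N & interlaced b k m])
     pieri_coef nu p k.
Proof.
move=> decr /=; case: (leqP (nu p) (\sum_i b i)) => [le_nu | gt_nu].
  have belowE k : [forall i, k i <= b i]%N && (\sum_i k i + nu p == \sum_i b i)%N =
                  below b k (\sum_i b i - nu p)%N.
    by congr (_ && _); apply/eqP/eqP; lia.
  rewrite (eq_bigl _ _ belowE) (pieri _ m) //; last exact: pieri_coef_antisym.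
  by apply: eq_bigl => k; rewrite andbA belowE.
have F (k : {ffun 'I_m -> 'I_N}) : (\sum_i k i + nu p == \sum_i b i)%N = false by lia.
by transitivity (0 : int); [|symmetry]; apply: big_pred0 => k; rewrite F ?andbF.
Qed.

(** Each factor adds a horizontal strip to the shape b - stair, which lengthens at
    most one more row than before; so p factors produce at most p rows, and the
    first r strips lie in the first r rows. *)
Lemma pieri_coef_support nu p b : (p <= m)%N -> strict_decr (fun i => b i) ->
  pieri_coef nu p b != 0 ->
  (forall i : 'I_m, (p <= i)%N -> b i = stair i :> nat) /\
  (forall r, (r <= p)%N ->
     (\sum_(i < m | i < r) (nu i + stair i) <= \sum_(i < m | i < r) b i)%N).
Proof.
elim: p b => [|p IHp] b le_pm decr nz_b.
  split=> [i _ | r]; last by rewrite leqn0 => /eqP->; rewrite !big_pred0.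
  have [w /eqfunP Ew] : exists w : 'S_m, [forall i, b i == stair (w i) :> nat].
    apply/existsP; apply: contraNT nz_b => /existsPn noW; rewrite /= acoefE big1 // => w _.
    case: eqfunP => [E | _]; last by rewrite mulr0.
    by case/negP: (noW w); apply/eqfunP=> j; have:= E j; rewrite !ffunE.
  rewrite Ew (_ : w = 1%g) ?perm1 //; apply: perm_partial_sums => r _.
  apply: leq_sum => j _; rewrite -Ew.
  have := @strict_decr_ge_stair (nat_vector b); rewrite /strict_decr => H.
  by have:= H _ j; rewrite ffunE; apply=> i' j' lt; rewrite !ffunE; apply: decr.
have [k /and3P[/forallP le_k sum_k int_k] nz_k] : exists2 k : {ffun 'I_m -> 'I_N},
    [&& [forall i, k i <= b i]%N, (\sum_i k i + nu p == \sum_i b i)%N & interlaced b k m]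
    & pieri_coef nu p k != 0.
  apply/exists_inP; apply: contraNT nz_b; rewrite negb_exists_in => /forall_inP H.
  by rewrite pieri_coefS // big1 // => k /H /negPn/eqP.
have decr_k := interlaced_decr decr le_k int_k.
have ge_stair i : (stair i <= b i)%N.
  have := @strict_decr_ge_stair (nat_vector b) _ i; rewrite ffunE; apply=> i' j' lt.
  by rewrite !ffunE; apply: decr.
have [stair_k sum_le] := IHp k (ltnW le_pm) decr_k nz_k.
have stair_b (i : 'I_m) : (p < i)%N -> b i = stair i :> nat.
  move=> lt_pi; apply/eqP; rewrite eqn_leq ge_stair andbT.
  have lt_i : (i.-1 < m)%N by apply: leq_ltn_trans (leq_pred i) (ltn_ord i).
  have := interlacedE (i := Ordinal lt_i) (j := i) int_k; rewrite stair_k /=; last by lia.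
  by rewrite /stair /= prednK ?(leq_trans _ lt_pi) // => /(_ erefl); have := ltn_ord i; lia.
split=> // r; rewrite leq_eqVlt => /orP[/eqP-> | lt_rp]; last first.
  by apply: leq_trans (sum_le _ lt_rp) _; apply: leq_sum => i _; apply: le_k.
pose ip := Ordinal le_pm.
have splitP (F : 'I_m -> nat) :
    (\sum_(i < m | i < p.+1) F i = F ip + \sum_(i < m | i < p) F i)%N.
  rewrite (bigD1 ip) //=; congr addn; apply: eq_bigl => i.
  by rewrite -val_eqE /=; lia.
have E : (\sum_(i < m | i < p.+1) b i = \sum_(i < m | i < p.+1) k i + nu p)%N.
  have splitS (c : {ffun 'I_m -> 'I_N}) : (\sum_i c i =
      \sum_(i < m | i < p.+1) c i + \sum_(i < m | ~~ (i < p.+1)) c i)%N.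
    exact: bigID.
  have tail_eq : (\sum_(i < m | ~~ (i < p.+1)) b i = \sum_(i < m | ~~ (i < p.+1)) k i)%N.
    by apply: eq_bigr => i; rewrite -leqNgt => lt_i; rewrite stair_b // stair_k // ltnW.
  by move/eqP: sum_k; rewrite (splitS b) (splitS k) tail_eq; lia.
by rewrite E !splitP (stair_k ip) //; have := sum_le p (leqnn p); rewrite /=; lia.
Qed.

(** When the shape has the row lengths nu, the bounds of [pieri_coef_support] are
    attained and force each strip to be exactly one row, so one filling remains. *)
Lemma pieri_coef_diag nu p b : (p <= m)%N ->
    (forall i j, (i <= j)%N -> (nu j <= nu i)%N) ->
    (forall i : 'I_m, b i = (if (i < p)%N then nu i else 0) + stair i :> nat)%N ->
  pieri_coef nu p b = 1.
Proof.
move=> le_pm noninc; elim: p b le_pm => [|p IHp] b le_pm Eb.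
  rewrite /= (_ : nat_vector b = addstair [ffun => 0%N]) ?acoef_dominated ?eqxx //.
  by apply/ffunP=> i; rewrite !ffunE Eb.
have decr : strict_decr (fun i => b i).
  move=> i j lt_ij; rewrite !Eb /stair; have := noninc _ _ (ltnW lt_ij).
  by have := ltn_ord j; do 2!case: ifP => ?; lia.
have lt_k (i : 'I_m) : ((if (i < p)%N then nu i else 0) + stair i < N)%N.
  by apply: leq_ltn_trans _ (ltn_ord (b i)); rewrite Eb; do 2!case: ifP => ?; lia.
(* k0 is the shape of the first p rows; it is the only one that contributes. *)
pose k0 := [ffun i => Ordinal (lt_k i)].
have Ek0 i : k0 i = (if (i < p)%N then nu i else 0) + stair i :> nat by rewrite ffunE.
pose ip := Ordinal le_pm.
have sumb : (\sum_i b i = \sum_i k0 i + nu p)%N.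
  have eq_off : (\sum_(i | i != ip) b i = \sum_(i | i != ip) k0 i)%N.
    apply: eq_bigr => i; rewrite -val_eqE /= Eb Ek0 => ?; congr addn.
    by do 2!case: ifP => ?; lia.
  have D1 (c : {ffun 'I_m -> 'I_N}) : (\sum_i c i = c ip + \sum_(i | i != ip) c i)%N.
    exact: bigD1.
  by rewrite !D1 eq_off Eb Ek0 /= ltnSn ltnn; lia.
rewrite pieri_coefS // (bigD1 k0) /=; last first.
  apply/and3P; split; last 2 first.
  - by rewrite sumb.
  - apply/forallP=> i; apply/forallP=> j; apply/implyP=> /andP[_ /eqP ji].
    rewrite Eb Ek0 /stair ji; have := ltn_ord j; have := noninc _ _ (leqnSn i).
    by do 2!case: ifP => ?; lia.
  - by apply/forallP=> i; rewrite Eb Ek0; do 2!case: ifP => ?; lia.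
rewrite IHp ?(ltnW le_pm) // big1 ?addr0 // => k /andP[/and3P[/forallP le_k _ int_k] nek].
apply: contraNeq nek => nz_k.
have decr_k := interlaced_decr decr le_k int_k.
have [stair_k sum_le] := pieri_coef_support (ltnW le_pm) decr_k nz_k.
apply/eqP/ffunP=> i; apply/val_inj; rewrite /= Ek0.
case: ifP => lt_ip; last by rewrite stair_k // leqNgt lt_ip.
apply/eqP; rewrite eqn_leq; apply/andP; split.
  by apply: leq_trans (le_k i) _; rewrite Eb (leqW lt_ip).
rewrite leqNgt; apply/negP=> lt_ki; have := sum_le p (leqnn p); apply/negP; rewrite -ltnNge.
rewrite (bigD1 i) //= [X in (_ < X)%N](bigD1 i) //= -addSn leq_add //.
apply: leq_sum => j /andP[lt_jp _]; apply: leq_trans (le_k j) _.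
by rewrite Eb (leqW lt_jp).
Qed.

End Pieri.
End Alternants.

(** * Tables with given column sums *)

Section ContingencyTables.

Variables (m n N : nat).

Definition add_column p (X : {ffun 'I_m * 'I_p -> 'I_n.+1} * {ffun 'I_m -> 'I_n.+1}) :
    {ffun 'I_m * 'I_p.+1 -> 'I_n.+1} :=
  [ffun ij => if unlift ord_max ij.2 is Some j then X.1 (ij.1, j) else X.2 ij.1].

Lemma add_column_bij p : bijective (@add_column p).
Proof.
exists (fun A : {ffun 'I_m * 'I_p.+1 -> 'I_n.+1} =>
          ([ffun ij => A (ij.1, lift ord_max ij.2)], [ffun i => A (i, ord_max)])) =>
            [[A g]|A].
  by congr (_, _); [apply/ffunP=> -[i j] | apply/ffunP=> i];
    rewrite !ffunE /= ?liftK ?unlift_none.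
apply/ffunP=> -[i j]; rewrite !ffunE /=.
by case: unliftP => [j' ->|->]; rewrite ?ffunE.
Qed.

Lemma add_column_last p X i : @add_column p X (i, ord_max) = X.2 i.
Proof. by rewrite ffunE unlift_none. Qed.

Lemma add_column_widen p X i (j : 'I_p) :
  @add_column p X (i, widen_ord (leqnSn p) j) = X.1 (i, j).
Proof.
rewrite ffunE /= (_ : widen_ord _ j = lift ord_max j) ?liftK //.
by apply: val_inj; rewrite /= /bump leqNgt ltn_ord.
Qed.

(** Removing the last column of a table subtracts that column from the row sums,
    which is one multiplication by a complete symmetric polynomial. *)
Lemma sum_acoef_tables nu p (b : {ffun 'I_m -> 'I_N}) :
  (forall j, (j < p)%N -> (nu j <= n)%N) ->
  \sum_(A : {ffun 'I_m * 'I_p -> 'I_n.+1} | [forall j, \sum_i A (i, j) == nu j]%N)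
     acoef (nat_vector b) [ffun i => \sum_j A (i, j)]%N = pieri_coef nu p b.
Proof.
elim: p b => [|p IHp] b le_nu.
  rewrite (big_pred1 [ffun => ord0]) /=.
    by congr acoef; apply/ffunP=> i; rewrite !ffunE big_ord0.
  move=> A; transitivity true; first by apply/forallP => -[].
  by apply/esym/eqP/ffunP=> -[i []].
rewrite (reindex (@add_column p)); last exact/onW_bij/add_column_bij.
have colsE (A : {ffun 'I_m * 'I_p -> 'I_n.+1}) (g : {ffun 'I_m -> 'I_n.+1}) :
  [forall j, \sum_i add_column (A, g) (i, j) == nu j]%N =
  (\sum_i g i == nu p)%N && [forall j, \sum_i A (i, j) == nu j]%N.
  apply/forallP/andP => [H | [Hg /forallP HA] j].
    split; last apply/forallP=> j.
      rewrite -(eqP (H ord_max)); apply/eqP/eq_bigr => i _.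
      by rewrite add_column_last.
    rewrite -[X in _ == X](eqP (H (widen_ord (leqnSn p) j))); apply/eqP/eq_bigr => i _.
    by rewrite add_column_widen.
  case: (unliftP ord_max j) => [j' -> | ->].
    rewrite lift_max -(eqP (HA j')); apply/eqP/eq_bigr => i _.
    by rewrite ffunE /= liftK.
  by rewrite -(eqP Hg); apply/eqP/eq_bigr => i _; rewrite add_column_last.
rewrite (eq_bigl (fun X : {ffun 'I_m * 'I_p -> 'I_n.+1} * {ffun 'I_m -> 'I_n.+1} =>
  (\sum_i X.2 i == nu p)%N && [forall j, \sum_i X.1 (i, j) == nu j]%N));
  last by case=> A g; rewrite colsE.
transitivity (\sum_(g : {ffun 'I_m -> 'I_n.+1} | (\sum_i g i == nu p)%N)
   \sum_(A : {ffun 'I_m * 'I_p -> 'I_n.+1} | [forall j, \sum_i A (i, j) == nu j]%N)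
     acoef (nat_vector b) [ffun i => [ffun i => \sum_j A (i, j)]%N i + nat_vector g i]%N).
  rewrite [RHS]pair_big /=
    [RHS](reindex (fun X : {ffun 'I_m * 'I_p -> 'I_n.+1} * {ffun 'I_m -> 'I_n.+1} =>
      (X.2, X.1))) /=; last first.
    by apply: onW_bij; exists (fun X => (X.2, X.1)) => -[].
  apply: eq_bigr => -[A g] _; congr acoef; apply/ffunP=> i; rewrite !ffunE big_ord_recr /=.
  rewrite add_column_last; congr addn; apply: eq_bigr => j _.
  by rewrite add_column_widen.
(* A column g and the vector b - g determine each other. *)
pose sub (g : {ffun 'I_m -> 'I_n.+1}) : {ffun 'I_m -> 'I_N} :=
  [ffun i => Ordinal (leq_ltn_trans (leq_subr (g i) (b i)) (ltn_ord (b i)))].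
transitivity (\sum_(g : {ffun 'I_m -> 'I_n.+1} |
    (\sum_i g i == nu p)%N && [forall i, g i <= b i]%N) pieri_coef nu p (sub g)).
  rewrite [RHS]big_mkcondr; apply: eq_bigr => g _.
  case: ifP => le_g.
    rewrite -IHp => [|j lt_j]; last by rewrite le_nu // ltnW.
    apply: eq_bigr => A _; rewrite acoef_add.
    rewrite (_ : [forall i, _] = true).
      by congr acoef; apply/ffunP=> i; rewrite !ffunE.
    by rewrite -le_g; apply: eq_forallb => i; rewrite !ffunE.
  rewrite big1 // => A _; rewrite acoef_add (_ : [forall i, _] = false) //.
  by rewrite -le_g; apply: eq_forallb => i; rewrite !ffunE.
pose sub' (k : {ffun 'I_m -> 'I_N}) : {ffun 'I_m -> 'I_n.+1} := [ffun i => inord (b i - k i)].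
rewrite (reindex_onto sub' sub) /=; last first.
  move=> g /andP[/eqP sum_g /forallP le_g]; apply/ffunP=> i; apply: val_inj.
  rewrite !ffunE /= subKn ?le_g //.
  by rewrite inordK.
apply: eq_big => [k | k /andP[_ /eqP->] //].
apply/andP/andP => [[/andP[/eqP sum_g /forallP le_g] /eqP subK] | [/forallP le_k /eqP sum_k]].
  have le_k i : (k i <= b i)%N by rewrite -subK ffunE /= leq_subr.
  split; first by apply/forallP.
  rewrite -sum_g -big_split /=; apply/eqP/eq_bigr => i _.
  have := congr1 (fun f : {ffun 'I_m -> 'I_N} => (f i : nat)) subK; rewrite /= ffunE /=.
  by have := le_g i; lia.
have sum_bk : (\sum_i (b i - k i) = nu p)%N.
  apply: (@addnI (\sum_i k i)%N); rewrite sum_k -big_split /=.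
  by apply: eq_bigr => i _; rewrite subnKC.
have val_sub i : sub' k i = (b i - k i)%N :> nat.
  rewrite ffunE inordK // ltnS (leq_trans _ (le_nu p (ltnSn p))) // -sum_bk.
  by rewrite (bigD1 i) //= leq_addr.
split; last by apply/eqP/ffunP=> i; apply: val_inj; rewrite ffunE /= val_sub subKn.
apply/andP; split; last by apply/forallP=> i; rewrite val_sub leq_subr.
by rewrite -sum_bk; apply/eqP/eq_bigr => i _; rewrite val_sub.
Qed.

End ContingencyTables.

(** * Permutation characters on colorings *)

Section Colorings.

Variable n : nat.
Local Notation SymG := [set: 'S_n]%G.

(** Two colorings using every color equally often are, as n-tuples, permutations of
    each other. *)
Lemma color_transitive (T : eqType) (c c' : 'I_n -> T) :
  (forall t, #|[pred x | c x == t]| = #|[pred x | c' x == t]|) ->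
  exists g : 'S_n, forall x, c' x = c (g x).
Proof.
move=> eqcc.
have cnt (d : 'I_n -> T) t : count (pred1 t) [tuple d x | x < n] = #|[pred x | d x == t]|.
  by rewrite /= count_map -sum1_count big_enum_cond /= -sum1_card; apply: eq_bigl.
have: perm_eq [tuple c' x | x < n] [tuple c x | x < n].
  by apply/allP=> t _; apply/eqP; rewrite /= !cnt eqcc.
case/tuple_permP=> g Eg; exists g => x.
have := congr1 (nth (c x) ^~ x) Eg.
by rewrite -!tnth_nth !tnth_mktuple.
Qed.

Lemma mem_level_stab (T : eqType) (c : 'I_n -> T) (g : 'S_n) :
  reflect (forall x, c (g x) = c x) (g \in level_stab c).
Proof. by rewrite inE; apply: eqfunP. Qed.

Section Content.

Variable T : finType.
Implicit Types (c : {ffun 'I_n -> T}) (mu : {ffun T -> nat}) (g : 'S_n).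

Definition content c : {ffun T -> nat} := [ffun t => #|[pred x | c x == t]|].

Lemma sum_content c : (\sum_t content c t = n)%N.
Proof.
rewrite -[RHS]card_ord -sum1_card (partition_big c xpredT) //=.
by apply: eq_bigr => t _; rewrite ffunE -sum1_card.
Qed.

Lemma content_perm c g : content [ffun x => c (g x)] = content c.
Proof.
apply/ffunP=> t; rewrite !ffunE -!sum1_card [RHS](reindex_inj (@perm_inj _ g)).
by apply: eq_bigl => x; rewrite !inE ffunE.
Qed.

Lemma content_orbit c c' : content c = content c' ->
  exists g : 'S_n, forall x, c' x = c (g x).
Proof.
by move=> /ffunP eqc; apply: color_transitive => t; have:= eqc t; rewrite !ffunE.
Qed.

Lemma content_exists mu : (\sum_t mu t = n)%N -> exists c, content c = mu.
Proof.
move=> sum_mu; pose s := flatten [seq nseq (mu t) t | t <- enum T].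
have size_s : size s == n.
  by rewrite size_flatten /shape -map_comp (eq_map (g := mu)) => [|t /=];
     rewrite ?size_nseq // sumnE big_map big_enum /= sum_mu.
exists [ffun x => tnth (Tuple size_s) x]; apply/ffunP=> t; rewrite ffunE.
transitivity (count (pred1 t) s).
  have Es : s = [seq tnth (Tuple size_s) x | x <- enum 'I_n] by rewrite map_tnth_enum.
  rewrite [in RHS]Es count_map -sum1_count big_enum_cond /= -sum1_card.
  by apply: eq_bigl => x; rewrite !inE ffunE.
rewrite /s count_flatten -map_comp sumnE big_map big_enum /= (bigD1 t) //=.
rewrite count_nseq /= eqxx mul1n big1 ?addn0 // => u /negPf ut.
by rewrite count_nseq /= ut.
Qed.

(** The permutation character of 'S_n on the colorings of content mu, which form a
    single orbit or, when the entries of mu do not add up to n, the empty set. *)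
Definition young_cf mu : 'CF(SymG) :=
  if [pick c | content c == mu] is Some c
  then 'Ind[SymG, level_stab_group c] 1 else 0.

Lemma card_color_fiber (c c' : {ffun 'I_n -> T}) :
  #|[set y : 'S_n | [forall x, c (y x) == c' x]]|
    = (#|level_stab c| * (content c == content c'))%N.
Proof.
case: eqP => [/content_orbit[y0 Ey0] | neqc].
  rewrite muln1 -[RHS](card_lcoset _ y0); congr #|pred_of_set _|; apply/setP=> y.
  rewrite mem_lcoset !inE; apply/eqfunP/eqfunP => [Ey x | Ey x].
    by rewrite permM Ey Ey0 permKV.
  by have:= Ey (y0 x); rewrite permM permK Ey0.
rewrite muln0; apply: eq_card0 => y; rewrite inE; apply/negP=> /eqfunP Ey.
case: neqc; rewrite -(content_perm c y); congr content; apply/ffunP=> x.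
by rewrite ffunE Ey.
Qed.

(** Every coloring of content content c0 is c0 o y for exactly #|level_stab c0|
    permutations y, and it is fixed by g if and only if g ^ y stabilizes c0. *)
Lemma cfInd_level_stabE (c0 : {ffun 'I_n -> T}) g :
  'Ind[SymG, level_stab_group c0] 1 g
    = #|[set c | (content c == content c0) && (g \in level_stab c)]|%:R.
Proof.
rewrite cfIndE ?subsetT //.
have fixP (c : {ffun 'I_n -> T}) (y : 'S_n) : [forall x, c0 (y x) == c x] ->
  ((g ^ y)%g \in level_stab c0) = (g \in level_stab c).
  move=> /eqfunP cy; apply/mem_level_stab/mem_level_stab => fc x.
    by rewrite -!cy -[in RHS]fc permJ.
  by rewrite -(permKV y x) permJ !cy fc.
transitivity (#|level_stab c0|%:R^-1 *
  \sum_(c : {ffun 'I_n -> T})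
    (#|[set y : 'S_n | [forall x, c0 (y x) == c x]]| * (g \in level_stab c))%:R : algC).
  congr (_ * _); rewrite (partition_big (fun y : 'S_n => [ffun x => c0 (y x)]) xpredT) //=.
  apply: eq_bigr => c _; rewrite -sum1_card big_distrl natr_sum /=.
  apply: eq_big => [y | y].
    rewrite in_setT inE; apply/eqP/eqfunP => [<- x|E]; first by rewrite ffunE.
    by apply/ffunP=> x; rewrite ffunE.
  case/andP=> _ /eqP Ec; rewrite cfun1E mul1n (fixP c) //.
  by apply/eqfunP=> x; rewrite -Ec ffunE.
rewrite -[in RHS]sum1_card natr_sum mulr_sumr [RHS]big_mkcond /=.
apply: eq_bigr => c _; rewrite (card_color_fiber c0 c) [c \in _]inE.
rewrite [content c == _]eq_sym; case: (content c0 == content c) => /=.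
  rewrite muln1 natrM mulKf; first by case: ifP.
  by rewrite pnatr_eq0 -lt0n (cardG_gt0 (level_stab_group c0)).
by rewrite muln0 mul0n mulr0.
Qed.

Lemma young_cfE mu g :
  young_cf mu g = #|[set c | (content c == mu) && (g \in level_stab c)]|%:R.
Proof.
rewrite /young_cf; case: pickP => [c0 /eqP <- | noc]; first exact: cfInd_level_stabE.
by rewrite cfunE eq_card0 // => c; rewrite inE noc.
Qed.

Lemma cfInd_level_stab (c : {ffun 'I_n -> T}) :
  'Ind[SymG, level_stab_group c] 1 = young_cf (content c).
Proof. by apply/cfunP=> g; rewrite cfInd_level_stabE young_cfE. Qed.

Lemma young_cf_char mu : young_cf mu \is a character.
Proof.
rewrite /young_cf; case: pickP => [c _ | _]; last exact: cfun0_char.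
by rewrite cfInd_char ?cfun1_char.
Qed.

Lemma cfdot_young1 mu : '[young_cf mu, 1] = (\sum_t mu t == n)%N%:R.
Proof.
rewrite /young_cf; case: pickP => [c /eqP <- | noc].
  by rewrite -Frobenius_reciprocity cfRes_cfun1 ?subsetT // cfnorm1 sum_content eqxx.
rewrite cfdot0l; case: eqP => // /content_exists[c Ec].
by case/eqP: (noc c).
Qed.

(** The sum of f (content c) over the colorings c fixed by a permutation, in a form
    that displays it as an integral combination of characters. *)
Definition color_cf (f : {ffun T -> nat} -> int) : 'CF(SymG) :=
  \sum_(mu : {ffun T -> 'I_n.+1}) (f (nat_vector mu))%:~R *: young_cf (nat_vector mu).

Lemma color_cfE f g :
  color_cf f g = \sum_(c : {ffun 'I_n -> T} | g \in level_stab c) (f (content c))%:~R.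
Proof.
rewrite sum_cfunE (partition_big
  (fun c => [ffun t => inord (content c t)] : {ffun T -> 'I_n.+1}) xpredT) //=.
apply: eq_bigr => mu _; rewrite cfunE young_cfE -sum1_card natr_sum mulr_sumr.
have Emu c : (content c == nat_vector mu) = ([ffun t => inord (content c t)] == mu).
  apply/eqP/eqP => [-> | <-]; apply/ffunP=> t; rewrite !ffunE ?inord_val //.
  by rewrite inordK // ltnS -[X in (_ <= X)%N](card_ord n) max_card.
apply: eq_big => [c | c]; rewrite inE; first by rewrite Emu andbC.
by case/andP=> /eqP-> _; rewrite mulr1.
Qed.

Lemma color_cf_vchar f : color_cf f \in 'Z[irr SymG].
Proof.
apply: rpred_sum => mu _; rewrite rpredZ_int ?intr_int //.
exact: char_vchar (young_cf_char _).
Qed.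

Lemma cfdot_color_cf1 f :
  '[color_cf f, 1] = (\sum_(mu : {ffun T -> 'I_n.+1} | (\sum_t mu t == n)%N) f
    (nat_vector mu))%:~R.
Proof.
rewrite cfdot_suml rmorph_sum [RHS]big_mkcond; apply: eq_bigr => mu _ /=.
rewrite cfdotZl cfdot_young1 (eq_bigr (fun t => mu t : nat)) => [|t _]; last by rewrite ffunE.
by case: ifP => _; rewrite ?mulr1 ?mulr0.
Qed.

End Content.

Lemma young_color_cf (T : finType) (nu : {ffun T -> nat}) :
  young_cf nu = color_cf (fun mu => (mu == nu)%:R).
Proof.
apply/cfunP=> g; rewrite young_cfE color_cfE -sum1_card natr_sum.
rewrite big_mkcond [RHS]big_mkcond /=; apply: eq_bigr => c _; rewrite inE.
by case: (_ == nu); case: (g \in _).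
Qed.

(** A pair of colorings is a coloring by pairs; its content is a table whose margins
    are the contents of the two colorings. *)
Lemma color_cfM (T1 T2 : finType) (f1 : {ffun T1 -> nat} -> int)
  (f2 : {ffun T2 -> nat} -> int) :
  color_cf f1 * color_cf f2 =
  color_cf (fun A : {ffun T1 * T2 -> nat} =>
    f1 [ffun i => \sum_j A (i, j)]%N * f2 [ffun j => \sum_i A (i, j)]%N).
Proof.
apply/cfunP=> g; rewrite cfunE !color_cfE big_distrlr /=.
rewrite pair_big /=.
pose h (p : {ffun 'I_n -> T1} * {ffun 'I_n -> T2}) := [ffun x => (p.1 x, p.2 x)].
have hbij : bijective h.
  exists (fun c : {ffun 'I_n -> T1 * T2} => ([ffun x => (c x).1], [ffun x => (c x).2])) =>
    [[c1 c2] | c].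
    by congr (_, _); apply/ffunP=> x; rewrite !ffunE.
  by apply/ffunP=> x; rewrite !ffunE -surjective_pairing.
rewrite [RHS](reindex h) /=; last exact: onW_bij.
apply: eq_big => [[c1 c2] | [c1 c2] _] /=.
  apply/andP/mem_level_stab => [[/mem_level_stab e1 /mem_level_stab e2] x | e12].
    by rewrite !ffunE /= e1 e2.
  by split; apply/mem_level_stab=> x; have:= e12 x; rewrite !ffunE => -[].
rewrite intrM; congr ((f1 _)%:~R * (f2 _)%:~R); apply/ffunP=> i; rewrite !ffunE.
  rewrite -sum1_card (partition_big c2 xpredT) //=; apply: eq_bigr => j _.
  by rewrite ffunE -sum1_card; apply: eq_bigl => x; rewrite !inE ffunE xpair_eqE.
rewrite -sum1_card (partition_big c1 xpredT) //=; apply: eq_bigr => j _.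
by rewrite ffunE -sum1_card; apply: eq_bigl => x; rewrite !inE ffunE xpair_eqE andbC.
Qed.

(** The inner product is the multiplicity of the trivial character in the product,
    and each table of total n indexes one transitive permutation character, in
    which the trivial character occurs once. *)
Lemma cfdot_color_young (T1 T2 : finType) (f : {ffun T1 -> nat} -> int)
  (nu : {ffun T2 -> nat}) :
  (\sum_j nu j = n)%N ->
  '[color_cf f, young_cf nu] =
  (\sum_(A : {ffun T1 * T2 -> 'I_n.+1} | [forall j, \sum_i A (i, j) == nu j]%N)
     f [ffun i => \sum_j A (i, j)]%N)%:~R.
Proof.
move=> sum_nu.
have -> : '[color_cf f, young_cf nu] = '[color_cf f * young_cf nu, 1].
  rewrite !cfdotE; congr (_ * _); apply: eq_bigr => g _.
  by rewrite cfunE young_cfE cfun1E inE conjC1 mulr1 conjC_nat.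
rewrite young_color_cf color_cfM cfdot_color_cf1; congr _%:~R.
rewrite big_mkcond [RHS]big_mkcond; apply: eq_bigr => A _ /=.
have -> : [ffun j => \sum_i nat_vector A (i, j)]%N =
  [ffun j => \sum_i A (i, j)]%N :> {ffun T2 -> nat}.
  by apply/ffunP=> j; rewrite !ffunE; apply: eq_bigr => i _; rewrite ffunE.
have -> : [ffun i => \sum_j nat_vector A (i, j)]%N =
  [ffun i => \sum_j A (i, j)]%N :> {ffun T1 -> nat}.
  by apply/ffunP=> i; rewrite !ffunE; apply: eq_bigr => j _; rewrite ffunE.
case: (_ =P nu) => [EA | nEA]; last first.
  rewrite mulr0 if_same; case: ifP => // /eqfunP EA; case: nEA.
  by apply/ffunP=> j; rewrite ffunE; apply: EA.
have EA' j : (\sum_i A (i, j) = nu j)%N by rewrite -EA ffunE.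
have -> : [forall j, \sum_i A (i, j) == nu j]%N by apply/eqfunP.
rewrite mulr1 (_ : _ == n) //; apply/eqP; rewrite -[RHS]sum_nu.
rewrite -(eq_bigr _ (fun j _ => EA' j)) exchange_big pair_big /=.
by apply: eq_bigr => -[].
Qed.

End Colorings.

(** * Jacobi-Trudi class functions *)

Section JacobiTrudi.

Variables (n m : nat).

(** The class function whose value at g is the coefficient of x^beta in the product
    of the Vandermonde alternant with p_g. *)
Definition jt_cf (beta : {ffun 'I_m -> nat}) : 'CF([set: 'S_n]%G) := color_cf n (acoef beta).

Variable a : nat -> nat.
Hypothesis noninc_a : forall i j, (i <= j)%N -> (a j <= a i)%N.
Let fa : {ffun 'I_m -> nat} := [ffun i : 'I_m => a i].
Hypothesis sum_a : (\sum_i fa i = n)%N.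

(* The vector a + stair with bounded entries, as [pieri_coef] requires. *)
Let bnd : {ffun 'I_m -> 'I_(a 0 + m).+1} := [ffun i : 'I_m => inord (a i + stair i)].

Let bndE i : bnd i = (a i + stair i)%N :> nat.
Proof.
by rewrite ffunE inordK // ltnS leq_add ?noninc_a //; apply: leq_subr.
Qed.

Lemma cfdot_jt_young (nu : nat -> nat) : (\sum_(i < m) nu i = n)%N ->
  '[jt_cf (addstair fa), young_cf n [ffun i : 'I_m => nu i]] = (pieri_coef nu m bnd)%:~R.
Proof.
move=> sum_nu; rewrite /jt_cf cfdot_color_young; last first.
  by rewrite -[RHS]sum_nu; apply: eq_bigr => i _; rewrite ffunE.
have <- : nat_vector bnd = addstair fa by apply/ffunP=> i; rewrite ffunE bndE !ffunE.
rewrite -(sum_acoef_tables (n := n)) => [|j lt_jm].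
  congr _%:~R; apply: eq_bigl => A; apply: eq_forallb => j.
  by rewrite ffunE.
by rewrite -sum_nu (bigD1 (Ordinal lt_jm)) //= leq_addr.
Qed.

Let decr_bnd : strict_decr (fun i => bnd i).
Proof.
move=> i j lt_ij; rewrite !bndE; have := noninc_a (ltnW lt_ij).
by have := ltn_ord j; rewrite /stair; lia.
Qed.

Lemma cfdot_jt_young_dom (nu : {ffun 'I_m -> nat}) :
  '[jt_cf (addstair fa), young_cf n nu] != 0 ->
  forall r, (r <= m)%N -> (\sum_(i < m | i < r) nu i <= \sum_(i < m | i < r) fa i)%N.
Proof.
have [sum_nu | sum_nu] := eqVneq (\sum_i nu i)%N n; last first.
  rewrite /young_cf; case: pickP => [c /eqP Ec | _]; last by rewrite cfdot0r eqxx.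
  by case/eqP: sum_nu; rewrite -Ec sum_content.
pose nu' j := if insub j is Some i then nu i else 0%N.
have Enu (i : 'I_m) : nu' i = nu i by rewrite /nu' valK.
have -> : nu = [ffun i : 'I_m => nu' i] by apply/ffunP=> i; rewrite ffunE Enu.
rewrite cfdot_jt_young; last by rewrite -[RHS]sum_nu; apply: eq_bigr.
rewrite intr_eq0 => /(pieri_coef_support (leqnn m) decr_bnd)[_ le_sum] r /le_sum.
have -> : (\sum_(i < m | i < r) bnd i =
  \sum_(i < m | i < r) fa i + \sum_(i < m | i < r) stair i)%N.
  by rewrite -big_split; apply: eq_bigr => i _; rewrite bndE ffunE.
rewrite big_split leq_add2r; congr (_ <= _)%N.
by apply: eq_bigr => i _; rewrite ffunE.
Qed.

Lemma cfdot_jt_young_diag : '[jt_cf (addstair fa), young_cf n fa] = 1.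
Proof.
rewrite cfdot_jt_young; last by rewrite -[RHS]sum_a; apply: eq_bigr => i _; rewrite ffunE.
by rewrite pieri_coef_diag // => i; rewrite bndE ltn_ord.
Qed.

(** Expand one factor along the characters young_cf mu. The other factor is
    orthogonal to those with mu not dominated by a, and the coefficients of those
    with mu dominated by a vanish unless mu = a. *)
Lemma cfnorm_jt : '[jt_cf (addstair fa)] = 1.
Proof.
have le_fa i : (fa i < n.+1)%N by rewrite ltnS -sum_a (bigD1 i) //= leq_addr.
pose mu0 : {ffun 'I_m -> 'I_n.+1} := [ffun i => Ordinal (le_fa i)].
have Emu0 : nat_vector mu0 = fa by apply/ffunP=> i; rewrite ffunE [mu0 i]ffunE.
rewrite {2}/jt_cf /color_cf cfdot_sumr (bigD1 mu0) //= cfdotZr Emu0 cfdot_jt_young_diag.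
rewrite acoef_dominated // eqxx rmorph1 mul1r big1 ?addr0 // => mu ne_mu.
rewrite cfdotZr; apply/eqP; apply: contraNT ne_mu => nz.
have nz2 : '[jt_cf (addstair fa), young_cf n (nat_vector mu)] != 0.
  by apply: contraNneq nz => ->; rewrite mulr0.
have dom := cfdot_jt_young_dom nz2.
move: nz; rewrite (acoef_dominated dom); case: (_ =P fa) => [E _ | _];
  last by rewrite mulr0z rmorph0 mul0r eqxx.
by apply/eqP/ffunP=> i; apply: val_inj; rewrite ffunE /= -E ffunE.
Qed.

Lemma jt_vchar beta : jt_cf beta \in 'Z[irr [set: 'S_n]%G].
Proof. exact: color_cf_vchar. Qed.

End JacobiTrudi.

(** * Sign characters and Young diagrams *)

Section SignedCharacters.

Variable n : nat.
Local Notation SymG := [set: 'S_n]%G.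

Lemma cfSign_char : cfSign n \is a character.
Proof.
pose rho (s : 'S_n) : 'M[algC]_1 := ((-1) ^+ odd_perm s)%:M.
have rhoP : mx_repr SymG rho.
  split=> [|s t _ _]; first by rewrite /rho odd_perm1.
  by rewrite /rho odd_permM signr_addb scalar_mxM.
have -> : cfSign n = cfRepr (MxRepresentation rhoP).
  by apply/cfunP=> s; rewrite cfunE cfunE inE mxtrace_scalar.
exact: cfRepr_char.
Qed.

(** If two points have the same color, multiplying by their transposition matches
    even with odd elements of the stabilizer; otherwise the stabilizer is trivial. *)
Lemma sum_sign_level_stab (T : eqType) (c : 'I_n -> T) :
  \sum_(g in level_stab c) (-1) ^+ odd_perm g = (injectiveb c)%:R :> algC.
Proof.
have [/injectiveP inj_c | /injectivePn[x [y nexy Ec]]] := boolP (injectiveb c).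
  rewrite (big_pred1 1%g) ?odd_perm1 // => g; apply/mem_level_stab/eqP => [E | -> x].
    by apply/permP=> x; rewrite perm1; apply: inj_c.
  by rewrite perm1.
have tc : tperm x y \in level_stab_group c.
  by apply/mem_level_stab=> z; case: tpermP => // ->.
set S := LHS; suff: S = - S by move/eqP; rewrite eq_sym eqNr => /eqP.
rewrite {1}/S (reindex_inj (mulgI (tperm x y))) /S -sumrN.
apply: eq_big => [g | g _]; first exact: groupMl.
by rewrite odd_permM odd_tperm nexy signr_addb expr1 mulN1r.
Qed.

(** By reciprocity the inner product averages signs over the permutations of the
    level sets of col that also fix c, that is over the stabilizer of the coloring
    by the pairs (c x, col x). *)
Lemma cfdot_color_sign (T : finType) (C : eqType) (col : 'I_n -> C)
  (f : {ffun T -> nat} -> int) :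
  '[color_cf n f, 'Ind[SymG] ('Res[level_stab_group col] (cfSign n))] =
  #|level_stab col|%:R^-1 *
  \sum_(c : {ffun 'I_n -> T} | injectiveb (fun x => (c x, col x))) (f (content c))%:~R.
Proof.
rewrite -cfdot_Res_l cfdotE; congr (_ * _).
transitivity (\sum_(g in level_stab col)
   \sum_(c : {ffun 'I_n -> T} | g \in level_stab c) (f (content c))%:~R *
     (-1) ^+ odd_perm g : algC).
  apply: eq_bigr => g Hg; rewrite !cfResE ?subsetT // color_cfE mulr_suml.
  by apply: eq_bigr => c _; rewrite cfunE rmorph_sign.
rewrite (exchange_big_dep xpredT) //= [RHS]big_mkcond; apply: eq_bigr => c _ /=.
rewrite -mulr_sumr (eq_bigl (fun g => g \in level_stab (fun x => (c x, col x)))) => [|g].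
  by rewrite sum_sign_level_stab; case: ifP; rewrite ?mulr1 ?mulr0.
apply/andP/mem_level_stab => [[/mem_level_stab e1 /mem_level_stab e2] x | e12].
  by rewrite e1 e2.
by split; apply/mem_level_stab=> x; case: (e12 x).
Qed.

End SignedCharacters.

Section Diagram.

Variables (n : nat) (a : intpart n).

Let row (x : 'I_n) := reshape_index a x.
Let col (x : 'I_n) := reshape_offset a x.

Lemma intpart_sumn : sumn a = n. Proof. by case: a => s /= /and3P[_ _ /eqP]. Qed.

Lemma intpart_noninc i j : (i <= j)%N -> (nth 0 a j <= nth 0 a i)%N.
Proof.
move=> le_ij; have [ge_j | lt_j] := leqP (size a) j; first by rewrite nth_default.
have /and3P[srt _ _] : is_intpart n a by case: a.
have tr : transitive geq by move=> x y z /= xy /leq_trans; apply.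
have rf : reflexive geq by move=> x /=.
by apply: (sorted_leq_nth tr rf 0%N srt) => //; rewrite inE ?(leq_ltn_trans le_ij).
Qed.

Lemma col_lt x : (col x < nth 0 a (row x))%N.
Proof. by apply: reshape_offsetP; rewrite intpart_sumn. Qed.

Lemma row_lt x : (row x < size a)%N.
Proof. by apply: reshape_indexP; rewrite intpart_sumn. Qed.

Lemma cell_inj : injective (fun x => (row x, col x)).
Proof.
by move=> x y [Er Ec]; apply: val_inj;
  rewrite -[LHS](reshape_indexK a) -[RHS](reshape_indexK a) [reshape_index _ _]Er
    [reshape_offset _ _]Ec.
Qed.

Lemma card_row i : #|[pred x | row x == i]| = nth 0 a i.
Proof.
have [lt_i | ge_i] := ltnP i (size a); last first.
  rewrite nth_default // eq_card0 // => x; rewrite !inE; apply/negP=> /eqP Ei.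
  by have := row_lt x; rewrite Ei ltnNge ge_i.
have lt_n (j : 'I_(nth 0 a i)) : (flatten_index a i j < n)%N.
  by rewrite -[X in (_ < X)%N]intpart_sumn flatten_indexP.
pose h j := Ordinal (lt_n j).
have h_inj : injective h.
  move=> j k /(congr1 val) /= /(congr1 (reshape_offset a)).
  by rewrite !flatten_indexKr // => /val_inj.
rewrite -[RHS]card_ord -(card_image h_inj); apply: eq_card => x.
rewrite inE; apply/eqP/imageP => [Er | [j _ ->]]; last by rewrite /row flatten_indexKl.
have lt_c : (col x < nth 0 a i)%N by rewrite -Er; apply: col_lt.
exists (Ordinal lt_c) => //; apply: val_inj => /=.
by rewrite -Er reshape_indexK.
Qed.

(** A coloring injective on the j-th column has at most r cells of that column with
    color below r, and at most all of them. The row coloring attains the smaller of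
    these bounds, since the column occupies an initial segment of the rows. *)
Lemma column_dominance (c : 'I_n -> nat) r j :
  injective (fun x => (c x, col x)) ->
  (#|[pred x | (col x == j) && (c x < r)]| <= #|[pred x | (col x == j) && (row x < r)]|)%N.
Proof.
move=> inj_c; have [/existsP[i le_a] | /existsPn all_a] :=
  boolP [exists i : 'I_r, nth 0 a i <= j]%N.
  apply: subset_leq_card; apply/subsetP=> x; rewrite !inE => /andP[/eqP cj _].
  rewrite cj eqxx ltnNge; apply/negP=> le_r.
  have := leq_trans (col_lt x) (intpart_noninc (leq_trans (ltnW (ltn_ord i)) le_r)).
  by rewrite cj ltnNge le_a.
apply: (@leq_trans r).
  pose A := [pred x | (col x == j) && (c x < r)%N].
  have [r0 | r_gt0] := posnP r.
    by rewrite eq_card0 // => x; rewrite inE r0 ltn0 andbF.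
  have inj_A : {in A &, injective (fun x => inord (c x) : 'I_r.-1.+1)}.
    move=> x y; rewrite !inE => /andP[/eqP xj xr] /andP[/eqP yj yr] /(congr1 val).
    by rewrite /= !inordK ?prednK // => Exy; apply: inj_c; rewrite /= Exy xj yj.
  by rewrite -(card_in_imset inj_A) (leq_trans (max_card _)) // card_ord prednK.
have lt_n (i : 'I_r) : (flatten_index a i j < n)%N.
  by rewrite -[X in (_ < X)%N]intpart_sumn flatten_indexP // ltnNge all_a.
pose h i := Ordinal (lt_n i).
have h_inj : injective h.
  move=> i k /(congr1 val) /= /(congr1 (reshape_index a)).
  by rewrite !flatten_indexKl ?ltnNge ?all_a // => /val_inj.
rewrite -[X in (X <= _)%N]card_ord -(card_image h_inj); apply: subset_leq_card.
apply/subsetP=> _ /imageP[i _ ->]; rewrite inE /row /col /=.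
by rewrite flatten_indexKl ?flatten_indexKr ?eqxx ?ltn_ord // ltnNge all_a.
Qed.

End Diagram.

(** * The Frobenius formula *)

Section IrrSym.

Variables (n m : nat) (a : intpart n).
Hypothesis size_a : (size a <= m)%N.
Local Notation SymG := [set: 'S_n]%G.

Let row (x : 'I_n) := reshape_index a x.
Let col (x : 'I_n) := reshape_offset a x.

Definition part_fun : {ffun 'I_m -> nat} := [ffun i : 'I_m => nth 0 a i]%N.

Lemma sum_part_fun : (\sum_i part_fun i = n)%N.
Proof.
rewrite -[RHS](intpart_sumn a) sumnE (big_nth 0%N) big_mkord (big_ord_widen m _ size_a).
rewrite [RHS]big_mkcond; apply: eq_bigr => i _ /=; rewrite ffunE.
by case: ltnP => // le_i; rewrite nth_default.
Qed.

(* The coloring of the cells by their rows, whose content is the shape itself. *)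
Let rowc : {ffun 'I_n -> 'I_m} := [ffun x => Ordinal (leq_trans (row_lt a x) size_a)].

Let rowcE x : rowc x = row x :> nat. Proof. by rewrite ffunE. Qed.

Lemma content_rowc : content rowc = part_fun.
Proof.
apply/ffunP=> i; rewrite !ffunE -card_row; apply: eq_card => x.
by rewrite !inE -val_eqE /= rowcE.
Qed.

Lemma Ind_row_stab : 'Ind[SymG, row_stab a] 1 = young_cf n part_fun.
Proof.
have -> : row_stab a = level_stab_group rowc.
  apply/group_inj/setP=> g; apply/mem_level_stab/mem_level_stab => E x.
    by apply: val_inj; rewrite /= !rowcE; apply: E.
  by have /(congr1 val) := E x; rewrite /= !rowcE.
by rewrite cfInd_level_stab content_rowc.
Qed.

(* Columns as a finite type, over which cells can be counted. *)
Let colo (x : 'I_n) : 'I_n.+1 := inord (col x).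

Let coloE x : colo x = col x :> nat.
Proof.
rewrite inordK // ltnS; apply: leq_trans (ltnW (col_lt a x)) _.
have lt_r := leq_trans (row_lt a x) size_a.
by rewrite -[X in (_ <= X)%N]sum_part_fun (bigD1 (Ordinal lt_r)) //= ffunE leq_addr.
Qed.

Let cnt (c : {ffun 'I_n -> 'I_m}) r (j : nat) := #|[pred x | (col x == j) && (c x < r)%N]|.

Lemma sum_content_lt (c : {ffun 'I_n -> 'I_m}) r :
  (\sum_(i < m | i < r) content c i = \sum_(j < n.+1) cnt c r j)%N.
Proof.
transitivity #|[pred x | c x < r]%N|.
  rewrite -sum1_card (partition_big c (fun i : 'I_m => (i < r)%N)) //=.
  apply: eq_bigr => i lt_i; rewrite ffunE -sum1_card; apply: eq_bigl => x.
  by rewrite !inE; case: eqP => [->|]; rewrite ?lt_i ?andbF.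
rewrite -sum1_card (partition_big colo xpredT) //=; apply: eq_bigr => j _.
by rewrite /cnt -sum1_card; apply: eq_bigl => x; rewrite !inE -val_eqE /= coloE andbC.
Qed.

Let cnt_row r j : cnt rowc r j = #|[pred x | (col x == j) && (row x < r)%N]|.
Proof. by apply: eq_card => x; rewrite !inE rowcE. Qed.

Let pair_nat_inj (c : {ffun 'I_n -> 'I_m}) :
  injectiveb (fun x => (c x, col x)) -> injective (fun x => (c x : nat, col x)).
Proof.
by move=> /injectiveP inj x y [/val_inj Ec El]; apply: inj; rewrite Ec El.
Qed.

Lemma content_dominated (c : {ffun 'I_n -> 'I_m}) r :
  injectiveb (fun x => (c x, col x)) ->
  (\sum_(i < m | i < r) content c i <= \sum_(i < m | i < r) part_fun i)%N.
Proof.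
move=> /pair_nat_inj inj; rewrite -content_rowc !sum_content_lt; apply: leq_sum => j _.
by rewrite cnt_row; apply: column_dominance inj.
Qed.

(** When the content of c is the shape, all the inequalities of [column_dominance]
    are equalities. Then c and the row coloring use each color equally often in
    each column, so they differ by a unique element of the column stabilizer. *)
Lemma card_column_injective :
  #|[set c : {ffun 'I_n -> 'I_m} | injectiveb (fun x => (c x, col x)) &&
    (content c == part_fun)]|
    = #|level_stab col|.
Proof.
have rowc_inj : injective (fun x => (rowc x, col x)).
  by move=> x y [] /(congr1 val); rewrite /= !rowcE => Er Ec; apply: (@cell_inj _ a);
    rewrite /= [reshape_index _ _]Er [reshape_offset _ _]Ec.
pose h (g : 'S_n) : {ffun 'I_n -> 'I_m} := [ffun x => rowc (g x)].
have hE g x : h g x = rowc (g x) by rewrite ffunE.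
have h_inj : {in level_stab col &, injective h}.
  move=> g g' /mem_level_stab Cg /mem_level_stab Cg' /ffunP E; apply/permP=> x.
  by apply: rowc_inj; have := E x; rewrite !ffunE Cg Cg' => ->.
rewrite -(card_in_imset h_inj); apply: eq_card => c; rewrite inE; apply/andP/imsetP.
  case=> inj_c /eqP Ec.
  have eq_cnt r j : cnt c r j = cnt rowc r j.
    have [lt_j | ge_j] := ltnP j n.+1; last first.
      by rewrite /cnt !eq_card0 // => x;
        rewrite !inE -coloE ltn_eqF // (leq_trans (ltn_ord _)).
    have le_c (j' : 'I_n.+1) : true ->
      (cnt c r j' <= cnt rowc r j' ?= iff (cnt c r j' == cnt rowc r j'))%N.
      by move=> _; split=> //; rewrite cnt_row; apply/column_dominance/pair_nat_inj.
    have [_] := leqif_sum le_c; rewrite -!sum_content_lt content_rowc Ec eqxx.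
    by move/esym/forallP/(_ (Ordinal lt_j))/eqP.
  have eq_fib i j : #|[pred x | (col x == j) && (c x == i)]| =
    #|[pred x | (col x == j) && (rowc x == i)]|.
    have cntS (d : {ffun 'I_n -> 'I_m}) :
        cnt d i.+1 j = (cnt d i j + #|[pred x | (col x == j) && (d x == i)]|)%N.
      rewrite /cnt -(cardID [pred x | d x < i]%N) /=; congr addn; apply: eq_card => x.
        by rewrite !inE ltnS; case: (ltnP (d x) i) => [/ltnW->|_]; rewrite ?andbT ?andbF.
      by rewrite !inE -val_eqE /=; case: (col x == j); rewrite ?andbF //=; apply/idP/idP; lia.
    by apply/eqP; have := cntS c; rewrite !eq_cnt cntS => /addnI ->.
  have [[i j] | g Eg] := @color_transitive n ('I_m * nat)%type
      (fun x => (rowc x, col x)) (fun x => (c x, col x)).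
    rewrite (eq_card (B := [pred x | (col x == j) && (rowc x == i)])) => [|x].
      by rewrite -eq_fib; apply: eq_card => x; rewrite !inE xpair_eqE andbC.
    by rewrite !inE xpair_eqE andbC.
  exists g; first by apply/mem_level_stab=> x; case: (Eg x).
  by apply/ffunP=> x; rewrite ffunE; case: (Eg x).
case=> g /mem_level_stab Cg ->; rewrite content_perm content_rowc; split=> //.
apply/injectiveP=> x y [Er Ec]; apply: (@perm_inj _ g); move: Er; rewrite !hE => Er.
by apply: rowc_inj; rewrite /= Er !Cg Ec.
Qed.

Let sgn_ind := 'Ind[SymG] ('Res[col_stab a] (cfSign n)).

Let sgn_ind_char : sgn_ind \is a character.
Proof. by rewrite cfInd_char ?cfRes_char ?cfSign_char. Qed.

Lemma cfdot_young_sign : '[young_cf n part_fun, sgn_ind] = 1.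
Proof.
rewrite young_color_cf cfdot_color_sign.
rewrite (_ : \sum_(_ | _) _ = #|level_stab col|%:R) ?mulVf //.
  by rewrite pnatr_eq0 -lt0n (cardG_gt0 (level_stab_group col)).
rewrite -card_column_injective -sum1_card natr_sum big_mkcond [RHS]big_mkcond.
by apply: eq_bigr => c _; rewrite inE; case: (injectiveb _) => //=; case: (_ == _).
Qed.

Lemma cfdot_jt_sign : '[jt_cf n (addstair part_fun), sgn_ind] = 1.
Proof.
rewrite -cfdot_young_sign young_color_cf !cfdot_color_sign; congr (_ * _).
apply: eq_bigr => c inj_c; rewrite acoef_dominated // => r _.
exact: content_dominated.
Qed.

(** A virtual character of norm 1 is an irreducible character up to sign, and here
    the inner product 1 with the induced sign character excludes the minus sign.
    This irreducible character occurs in both induced characters; these have no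
    other common constituent, as their inner product is 1. *)
Theorem irr_sym_jt : irr_sym a = jt_cf n (addstair part_fun).
Proof.
have norm_jt : '[jt_cf n (addstair part_fun)] = 1.
  by apply: cfnorm_jt; [apply: intpart_noninc | apply: sum_part_fun].
have [b [i Ei]] := vchar_norm1P (jt_vchar n (addstair part_fun)) norm_jt.
have dot_sgn : (-1) ^+ b * '['chi_i, sgn_ind] = 1 by rewrite -[RHS]cfdot_jt_sign Ei cfdotZl.
have [p Ep] := natrP (Cnat_cfdot_char (irr_char i) sgn_ind_char).
have b0 : b = false.
  case: b dot_sgn {Ei} => //=; rewrite expr1 mulN1r Ep => E.
  have : (0 : algC) <= - 1 by rewrite -E opprK ler0n.
  by rewrite oppr_ge0 ler10.
rewrite b0 expr0 mul1r in dot_sgn; rewrite b0 expr0 scale1r in Ei.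
have dot_young : '['chi_i, young_cf n part_fun] = 1.
  by rewrite -Ei; apply: cfdot_jt_young_diag; [apply: intpart_noninc | apply: sum_part_fun].
rewrite Ei /irr_sym; congr 'chi__; rewrite /irr_sym_index Ind_row_stab -/sgn_ind.
case: pickP => [j /andP[] | none] /=; last first.
  have := none i; rewrite !irr_consttE ![ '[_, 'chi_i]]cfdotC dot_young dot_sgn.
  by rewrite conjC1 oner_eq0.
rewrite !irr_consttE => nz_young nz_sgn; apply/eqP; apply: contraTT isT => ne_ji.
have [q1 Eq1] := natrP (Cnat_cfdot_char (young_cf_char _ part_fun) (irr_char j)).
have [q2 Eq2] := natrP (Cnat_cfdot_char sgn_ind_char (irr_char j)).
have := cfdot_young_sign; rewrite cfdot_sum_irr (bigD1 i) //= (bigD1 j) //=.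
rewrite [ '[_, 'chi_i]]cfdotC dot_young [ '[sgn_ind, 'chi_i]]cfdotC dot_sgn.
rewrite Eq1 Eq2 !conjC1 mulr1 conjC_nat -natrM => /eqP.
rewrite -subr_eq0 addrAC subrr add0r => /eqP E.
(* A second common constituent j would make the inner product exceed 1. *)
have rest_ge0 : 0 <= \sum_(k | (k != i) && (k != j))
    '[young_cf n part_fun, 'chi_k] * ('[sgn_ind, 'chi_k])^* :> algC.
  apply: sumr_ge0 => k _.
  have [r1 ->] := natrP (Cnat_cfdot_char (young_cf_char _ part_fun) (irr_char k)).
  have [r2 ->] := natrP (Cnat_cfdot_char sgn_ind_char (irr_char k)).
  by rewrite conjC_nat -natrM ler0n.
have : (q1 * q2)%:R + (\sum_(k | (k != i) && (k != j))
    '[young_cf n part_fun, 'chi_k] * ('[sgn_ind, 'chi_k])^* ) > 0 :> algC.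
  rewrite ltr_wpDr // ltr0n muln_gt0 !lt0n.
  by rewrite -2!(eqr_nat algC) -Eq1 -Eq2 nz_young.
by rewrite E ltxx.
Qed.

End IrrSym.

(** * Alternating functions of contents *)

Section Sorting.

Variable m : nat.
Implicit Types (eta : {ffun 'I_m -> nat}) (v : 'S_m).

Definition alternating (kappa : {ffun 'I_m -> nat} -> int) :=
  forall eta v, kappa [ffun i => eta (v i)] = (-1) ^+ odd_perm v * kappa eta.

Definition decrb eta := [forall i : 'I_m, forall j : 'I_m, (i < j)%N ==> (eta j < eta i)%N].

Lemma decrP eta : reflect (strict_decr eta) (decrb eta).
Proof.
apply: (iffP forallP) => [H i j lt_ij | H i]; first by move/forallP/(_ j)/implyP: (H i);
  apply.
by apply/forallP=> j; apply/implyP; apply: H.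
Qed.

Lemma alternating_inj kappa eta : alternating kappa -> kappa eta != 0 -> injective eta.
Proof.
move=> alt_k nz i j Eij; apply/eqP; apply: contraNT nz => ne_ij.
have := alt_k eta (tperm i j); rewrite odd_tperm ne_ij expr1 mulN1r.
rewrite (_ : [ffun _ => _] = eta) => [|]; first by lia.
by apply/ffunP=> k; rewrite ffunE; case: tpermP => [->|->|].
Qed.

Lemma incr_perm1 v : (forall i j : 'I_m, (i < j)%N -> (v i < v j)%N) -> v = 1%g.
Proof.
move=> incr; apply: perm_partial_sums => r _; apply: leq_sum => i _.
have := @strict_decr_ge_stair m [ffun k => stair (v k)] _ i; rewrite ffunE; apply.
move=> j k lt_jk; rewrite !ffunE /stair; have := incr _ _ lt_jk.
by have := ltn_ord (v k); lia.
Qed.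

Lemma decr_perm_unique eta v v' :
  strict_decr (fun i => eta (v i)) -> strict_decr (fun i => eta (v' i)) -> v = v'.
Proof.
move=> dv dv'; suff /eqP : (v' * v^-1)%g = 1%g by rewrite mulg_eq1 invgK => /eqP.
apply: incr_perm1 => i j lt_ij; rewrite !permM.
have := dv' _ _ lt_ij; rewrite -{1}(permKV v (v' i)) -{1}(permKV v (v' j)).
case: (ltngtP ((v^-1)%g (v' i)) ((v^-1)%g (v' j))) => // [gt | /val_inj -> ];
  last by rewrite ltnn.
by move/(ltn_trans (dv _ _ gt)); rewrite ltnn.
Qed.

Lemma decr_perm_exists eta : injective eta -> exists v, strict_decr (fun i => eta (v i)).
Proof.
move=> inj; pose t := [tuple eta i | i < m].
have /tuple_permP[v Ev] : perm_eq (sort geq t) t by rewrite perm_sort.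
exists v => i j lt_ij.
have E k : nth 0%N (sort geq t) (k : 'I_m) = eta (v k).
  by rewrite Ev -tnth_nth !tnth_mktuple.
have tot : total geq by move=> x y; apply: leq_total.
have tr : transitive geq by move=> x y z /= xy /leq_trans; apply.
have rf : reflexive geq by move=> x /=.
have := sorted_leq_nth tr rf 0%N (sort_sorted tot t) i j.
rewrite !inE size_sort size_tuple !ltn_ord => /(_ isT isT (ltnW lt_ij)).
rewrite /= !E leq_eqVlt => /orP[/eqP /inj /perm_inj ji | //].
by rewrite ji ltnn in lt_ij.
Qed.

(** If eta has two equal entries then kappa eta = 0; otherwise exactly one
    permutation makes eta strictly decreasing. *)
Lemma alternating_sort kappa eta : alternating kappa ->
  kappa eta = \sum_(v : 'S_m | decrb [ffun i => eta (v i)])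
                (-1) ^+ odd_perm v * kappa [ffun i => eta (v i)].
Proof.
move=> alt_k; have eqv v : (-1) ^+ odd_perm v * kappa [ffun i => eta (v i)] = kappa eta.
  by rewrite alt_k mulrA -signr_addb addbb mul1r.
under [RHS]eq_bigr do rewrite eqv.
have [-> | nz] := eqVneq (kappa eta) 0; first by rewrite big1.
have [v dv] := decr_perm_exists (alternating_inj alt_k nz).
rewrite (big_pred1 v) // => u; apply/decrP/eqP => [du | ->].
  by apply: (@decr_perm_unique eta) dv => i j; have := du i j; rewrite !ffunE.
by move=> i j; rewrite !ffunE; apply: dv.
Qed.

End Sorting.

Lemma nth_filter_nz (s : seq nat) i : sorted geq s -> nth 0%N [seq x <- s | x != 0%N] i =
  nth 0%N s i.
Proof.
have tr : transitive geq by move=> x y z /= xy /leq_trans; apply.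
elim: s i => //= x s IHs i srt; have srt_s := path_sorted srt.
case: eqP => [x0 | _] /=; last by case: i => //= i; apply: IHs.
have s0 y : y \in s -> y = 0%N.
  by move=> sy; have /allP/(_ y sy) := order_path_min tr srt; rewrite /= x0 leqn0 => /eqP.
rewrite (eq_in_filter (a2 := pred0)) => [|y /s0 -> //]; rewrite filter_pred0 nth_nil.
case: i => [|i] /=; first by rewrite x0.
by have [lt_i|?] := ltnP i (size s);
  [rewrite (s0 (nth _ _ _)) ?mem_nth | rewrite nth_default].
Qed.

(** Partitions are stored without zero parts, so the zeros ending a nonincreasing
    vector are removed; reading beyond the end restores them. *)
Lemma intpart_exists n (s : seq nat) : sorted geq s -> sumn s = n ->
  exists2 a : intpart n, (size a <= size s)%N & forall i, nth 0%N a i = nth 0%N s i.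
Proof.
move=> srt sum_s; pose s' := [seq x <- s | x != 0%N].
have tr : transitive geq by move=> x y z /= xy /leq_trans; apply.
have Ps' : is_intpart n s'.
  apply/and3P; split; first exact: sorted_filter.
    by rewrite mem_filter eqxx.
  rewrite -sum_s /s' {srt sum_s s'}; elim: s => //= x s /eqP IHs.
  by case: (x =P 0%N) => [->|_] /=; rewrite IHs.
exists (IntPart Ps') => [|i] /=; first by rewrite size_filter count_size.
exact: nth_filter_nz.
Qed.

Lemma intpart_inj n (a b : intpart n) : (forall i, nth 0%N a i = nth 0%N b i) -> a = b.
Proof.
move=> Eab.
have no0 (c : intpart n) i : (i < size c)%N -> nth 0%N c i != 0%N.
  case: c => s /= /and3P[_ n0 _] lt_i; apply: contraNneq n0 => <-.
  by rewrite mem_nth.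
have le_size (c d : intpart n) : (forall i, nth 0%N c i = nth 0%N d i) ->
  (size c <= size d)%N.
  move=> Ecd; rewrite leqNgt; apply/negP=> /no0.
  by rewrite Ecd nth_default ?eqxx.
apply: val_inj; apply: (@eq_from_nth _ 0%N) => //.
by apply/eqP; rewrite eqn_leq !le_size.
Qed.

Section Expansion.

Variables (n m : nat).

Lemma addstair_decr (a : intpart n) : strict_decr (addstair (part_fun m a)).
Proof.
move=> i j lt_ij; rewrite !ffunE; have := intpart_noninc a (ltnW lt_ij).
by rewrite /stair; have := ltn_ord j; lia.
Qed.

Lemma decr_intpart (eta : {ffun 'I_m -> nat}) :
  (\sum_i eta i = n + \sum_(i < m) stair i)%N -> strict_decr eta ->
  exists2 a : intpart n, (size a <= m)%N & addstair (part_fun m a) = eta.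
Proof.
move=> sum_eta decr; have ge_stair := strict_decr_ge_stair decr.
pose s := [seq (eta i - stair i)%N | i : 'I_m].
have size_s : size s = m by rewrite size_map size_enum_ord.
have nth_s (i : 'I_m) : nth 0%N s i = (eta i - stair i)%N.
  by rewrite (nth_map i) ?size_enum_ord // nth_ord_enum.
have srt : sorted geq s.
  apply/(sortedP 0%N) => i; rewrite size_s => lt_i.
  rewrite (nth_s (Ordinal lt_i)) (nth_s (Ordinal (ltnW lt_i))) /=.
  have := decr (Ordinal (ltnW lt_i)) (Ordinal lt_i) (ltnSn i).
  by rewrite /stair /=; lia.
have sum_s : sumn s = n.
  rewrite sumnE big_map big_enum /=; apply/eqP.
  rewrite -(eqn_add2r (\sum_(i < m) stair i)) -sum_eta -big_split /=.
  by apply/eqP/eq_bigr => i _; rewrite subnK.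
have [a le_a Ea] := intpart_exists srt sum_s; exists a; first by rewrite -size_s.
by apply/ffunP=> i; rewrite !ffunE Ea nth_s subnK.
Qed.

Lemma part_fun_inj (a b : intpart n) : (size a <= m)%N -> (size b <= m)%N ->
  addstair (part_fun m a) = addstair (part_fun m b) -> a = b.
Proof.
move=> sa sb /ffunP E; apply: intpart_inj => i.
have [lt_i | ge_i] := ltnP i m.
  by have := E (Ordinal lt_i); rewrite !ffunE => /addIn.
by rewrite !nth_default // (leq_trans _ ge_i).
Qed.

Lemma sum_intpart_decr (kappa : {ffun 'I_m -> nat} -> int) (eta : {ffun 'I_m -> nat}) :
  (\sum_i eta i = n + \sum_(i < m) stair i)%N ->
  \sum_(a : intpart n | (size a <= m)%N)
     kappa (addstair (part_fun m a)) * (addstair (part_fun m a) == eta)%:R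
  = (decrb eta)%:R * kappa eta.
Proof.
move=> sum_eta; case: decrP => [/(decr_intpart sum_eta)[a sa Ea] | ndecr].
  rewrite (bigD1 a) //= big1 ?addr0 => [|b /andP[sb ne_ba]].
    by rewrite Ea eqxx mulr1 mul1r.
  rewrite -Ea; case: eqP => [/part_fun_inj E | _]; last by rewrite mulr0.
  by rewrite E ?eqxx in ne_ba.
rewrite mul0r big1 // => a sa; case: eqP => [E | _]; last by rewrite mulr0.
by case: ndecr; rewrite -E; apply: addstair_decr.
Qed.

Lemma content_recolor (c : {ffun 'I_n -> 'I_m}) (v : 'S_m) :
  content [ffun x => (v^-1)%g (c x)] = [ffun i => content c (v i)].
Proof.
apply/ffunP=> i; rewrite !ffunE; apply: eq_card => x; rewrite !inE ffunE.
by rewrite -(inj_eq (@perm_inj _ v)) permKV.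
Qed.

(** Permuting the colors permutes the colorings that are fixed by g. *)
Lemma recolor_sum (g : 'S_n) (v : 'S_m) (phi : {ffun 'I_m -> nat} -> int) :
  \sum_(c : {ffun 'I_n -> 'I_m} | g \in level_stab c) phi [ffun i => content c (v i)] =
  \sum_(c : {ffun 'I_n -> 'I_m} | g \in level_stab c) phi (content c).
Proof.
rewrite [RHS](reindex (fun c : {ffun 'I_n -> 'I_m} => [ffun x => (v^-1)%g (c x)])) /=;
  last first.
  apply: onW_bij; exists (fun c : {ffun 'I_n -> 'I_m} => [ffun x => v (c x)]) => c;
    by apply/ffunP=> x; rewrite !ffunE ?permK ?permKV.
apply: eq_big => [c | c _]; last by rewrite content_recolor.
apply/mem_level_stab/mem_level_stab => E x; first by rewrite !ffunE E.
by have := E x; rewrite !ffunE => /perm_inj.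
Qed.

(** This is the expansion of p_g in Schur functions with coefficients [a](g), paired
    with kappa. Sorting content c + stair by a permutation v replaces stair by
    stair o v, once the effect of v on the content is absorbed in a permutation of
    the colors; summing over v with signs gives the Frobenius formula for the
    partition obtained. *)
Theorem alternant_expansion (kappa : {ffun 'I_m -> nat} -> int) (g : 'S_n) : alternating
  kappa ->
  (\sum_(c : {ffun 'I_n -> 'I_m} | g \in level_stab c) kappa (addstair (content c)))%:~R =
  \sum_(a : intpart n | (size a <= m)%N) (kappa (addstair (part_fun m a)))%:~R * irr_sym a g.
Proof.
move=> alt_k.
transitivity ((\sum_(a : intpart n | (size a <= m)%N) kappa (addstair (part_fun m a)) *
   \sum_(c : {ffun 'I_n -> 'I_m} | g \in level_stab c) acoef (addstair (part_fun m a))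
     (content c))%:~R : algC);
  last first.
  rewrite rmorph_sum; apply: eq_bigr => a sa; rewrite rmorphM /= (irr_sym_jt sa).
  by rewrite color_cfE rmorph_sum.
congr _%:~R; under [RHS]eq_bigr do rewrite big_distrr /=.
rewrite [RHS]exchange_big /=.
pose rot (w : 'S_m) (mu : {ffun 'I_m -> nat}) : {ffun 'I_m -> nat} :=
  [ffun i => mu i + stair (w i)]%N.
pose F w mu : int := (-1) ^+ odd_perm w * ((decrb (rot w mu))%:R * kappa (rot w mu)).
transitivity (\sum_(c : {ffun 'I_n -> 'I_m} | g \in level_stab c) \sum_w F w (content c));
  last first.
  apply: eq_bigr => c _; under [RHS]eq_bigr do rewrite acoefE big_distrr /=.
  rewrite [RHS]exchange_big /=; apply: eq_bigr => w _.
  rewrite /F -(sum_intpart_decr kappa); last first.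
    transitivity (\sum_i content c i + \sum_i stair (w i))%N.
      by rewrite -big_split; apply: eq_bigr => i _; rewrite ffunE.
    by rewrite sum_content [in RHS](reindex_inj (@perm_inj _ w)).
  rewrite big_distrr /=; apply: eq_bigr => a _. rewrite [RHS]mulrCA; congr (_ * (_ * _)).
  congr (_%:R : int); congr nat_of_bool.
  by apply/eqP/eqfunP => [-> i | E];
    [rewrite [LHS]ffunE | apply/ffunP=> i; rewrite E [RHS]ffunE].
rewrite exchange_big /=.
under [RHS]eq_bigr => w _ do rewrite -(recolor_sum g w).
rewrite -[RHS]exchange_big /=; apply: eq_bigr => c _.
rewrite (alternating_sort _ alt_k) big_mkcond; apply: eq_bigr => v _; rewrite /F.
have -> : [ffun i => addstair (content c) (v i)] = rot v [ffun i => content c (v i)].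
  by apply/ffunP=> i; rewrite !ffunE.
by case: ifP; rewrite ?mul1r ?mul0r ?mulr0.
Qed.

End Expansion.

(** * Traces of permuted tensor powers *)

Section PermutationTrace.

Variables (n : nat) (R : comNzRingType).
Implicit Type g : 'S_n.

(** The trace of the n-th tensor power of the matrix M, composed with the
    permutation g of the tensor factors. *)
Definition perm_trace g (T : finType) (M : T -> T -> R) : R :=
  \sum_(c : {ffun 'I_n -> T}) \prod_x M (c (g x)) (c x).

Lemma eq_perm_trace g (T : finType) (M M' : T -> T -> R) :
  (forall t u, M t u = M' t u) -> perm_trace g M = perm_trace g M'.
Proof. by move=> E; apply: eq_bigr => c _; apply: eq_bigr => x _. Qed.

(** The cyclicity of the trace, for tensor powers of rectangular matrices, which
    commute with the permutation of the factors. *)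
Lemma perm_traceC g (T U : finType) (A : T -> U -> R) (B : U -> T -> R) :
  perm_trace g (fun t t' => \sum_u A t u * B u t') =
  perm_trace g (fun u u' => \sum_t B u t * A t u').
Proof.
rewrite /perm_trace.
under eq_bigr do rewrite bigA_distr_bigA.
under [RHS]eq_bigr do rewrite bigA_distr_bigA.
rewrite [RHS]exchange_big /=.
rewrite (reindex (fun c : {ffun 'I_n -> T} => [ffun x => c ((g^-1)%g x)])) /=; last first.
  apply: onW_bij; exists (fun c : {ffun 'I_n -> T} => [ffun x => c (g x)]) => c;
    by apply/ffunP=> x; rewrite !ffunE ?permK ?permKV.
apply: eq_bigr => c _; apply: eq_bigr => s _; rewrite !big_split /= mulrC.
congr (_ * _); last by apply: eq_bigr => x _; rewrite ffunE permK.
rewrite (reindex_inj (@perm_inj _ g)); apply: eq_bigr => x _.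
by rewrite ffunE permK.
Qed.

Lemma prod_content (T : finType) (c : {ffun 'I_n -> T}) (d : T -> R) :
  \prod_x d (c x) = \prod_t d t ^+ content c t.
Proof.
rewrite (partition_big c xpredT) //=; apply: eq_bigr => t _.
by rewrite ffunE -prodr_const; apply: eq_bigr => x /eqP->.
Qed.

Lemma perm_trace_diag g (T : finType) (d : T -> R) :
  perm_trace g (fun t u => if t == u then d u else 0) =
  \sum_(c : {ffun 'I_n -> T} | g \in level_stab c) \prod_t d t ^+ content c t.
Proof.
rewrite [RHS]big_mkcond; apply: eq_bigr => c _ /=.
case: mem_level_stab => [fix_c | nfix].
  by rewrite -prod_content; apply: eq_bigr => x _; rewrite fix_c eqxx.
have [x nfx] : exists x, c (g x) != c x.
  by apply/existsP; rewrite -negb_forall; apply/negP=> /eqfunP.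
by rewrite (bigD1 x) //= (negPf nfx) mul0r.
Qed.

(** A coloring by pairs contributes only if it has the form (b x, b (g x)), where
    the second component of the constraint says that b is fixed by g ^+ 2. *)
Lemma perm_trace_swap g (T : finType) (y : T -> R) :
  perm_trace g (fun t u : T * T => if (t.1 == u.2) && (t.2 == u.1) then y u.1 * y u.2 else 0)
    =
  \sum_(b : {ffun 'I_n -> T} | (g ^+ 2)%g \in level_stab b) \prod_t y t ^+ (2 * content b t).
Proof.
pose h (b : {ffun 'I_n -> T}) := [ffun x => (b x, b (g x))].
pose h' (c : {ffun 'I_n -> T * T}) := [ffun x => (c x).1].
rewrite /perm_trace (bigID (fun c : {ffun 'I_n -> T * T} => h (h' c) == c)) /=.
rewrite [X in _ + X]big1 ?addr0 => [|c ne_c]; last first.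
  have [x nx] : exists x, (c (g x)).1 != (c x).2.
    apply/existsP; rewrite -negb_forall; apply: contraNN ne_c => /eqfunP E.
    by apply/eqP/ffunP=> x; rewrite !ffunE E -surjective_pairing.
  by rewrite (bigD1 x) //= (negPf nx) mul0r.
rewrite (reindex_onto h h') /=; last by move=> c /eqP.
rewrite (eq_bigl xpredT) => [|b]; last first.
  have -> : h' (h b) = b by apply/ffunP=> x; rewrite !ffunE.
  by rewrite !eqxx.
rewrite [RHS]big_mkcond; apply: eq_bigr => b _ /=.
case: mem_level_stab => [fix_b | nfix].
  transitivity ((\prod_x y (b x)) * \prod_x y (b (g x))).
    rewrite -big_split; apply: eq_bigr => x _; rewrite !ffunE /= eqxx /=.
    by have := fix_b x; rewrite permM => ->; rewrite eqxx.
  rewrite -(reindex_inj (P := xpredT) (F := fun x => y (b x)) (@perm_inj _ g)) -expr2.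
  rewrite prod_content -prodrXl; apply: eq_bigr => t _.
  by rewrite mulnC exprM.
have [x nfx] : exists x, b ((g ^+ 2)%g x) != b x.
  by apply/existsP; rewrite -negb_forall; apply/negP=> /eqfunP.
rewrite permM in nfx.
by rewrite (bigD1 x) //= !ffunE /= (negPf nfx) andbF mul0r.
Qed.

End PermutationTrace.

Local Notation o4 k := (@Ordinal 4 k isT).
Local Notation o2 k := (@Ordinal 2 k isT).

Section SquareColorings.

Local Notation Q := {poly algC}.

(** The exchange of the factors of V (x) V, weighted by X for the first basis vector
    of V, is the product of [A], whose columns are its eigenvectors, and of [B],
    which is the inverse of [A] with its rows scaled by the eigenvalues [d]. *)
Let A (t : 'I_2 * 'I_2) (u : 'I_4) : Q :=
  match nat_of_ord t.1, nat_of_ord t.2, nat_of_ord u with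
  | 0%N, 0%N, 0%N => 1
  | 1%N, 1%N, 1%N => 1
  | 0%N, 1%N, 2%N => 1 | 1%N, 0%N, 2%N => 1
  | 0%N, 1%N, 3%N => 1 | 1%N, 0%N, 3%N => -1
  | _, _, _ => 0
  end.

Let half : Q := (2^-1)%:P.

Let B (u : 'I_4) (t : 'I_2 * 'I_2) : Q :=
  match nat_of_ord t.1, nat_of_ord t.2, nat_of_ord u with
  | 0%N, 0%N, 0%N => 'X ^+ 2
  | 1%N, 1%N, 1%N => 1
  | 0%N, 1%N, 2%N => half * 'X | 1%N, 0%N, 2%N => half * 'X
  | 0%N, 1%N, 3%N => - (half * 'X) | 1%N, 0%N, 3%N => half * 'X
  | _, _, _ => 0
  end.

Let y (t : 'I_2) : Q := if nat_of_ord t == 0%N then 'X else 1.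

Let d (u : 'I_4) : Q :=
  match nat_of_ord u with 0%N => 'X ^+ 2 | 1%N => 1 | 2%N => 'X | _ => - 'X end.

Let halfD : half + half = 1.
Proof. by rewrite /half -polyCD -mulr2n -[_ *+ 2]mulr_natr mulVf ?pnatr_eq0. Qed.

Lemma ord2_ind (P : 'I_2 -> Prop) : P (o2 0) -> P (o2 1) -> forall i, P i.
Proof.
by move=> P0 P1 [[|[|i]] Hi] //; [have -> : Hi = isT by apply: eq_irrelevance
 | have -> : Hi = isT by apply: eq_irrelevance].
Qed.

Lemma ord4_ind (P : 'I_4 -> Prop) : P (o4 0) -> P (o4 1) -> P (o4 2) -> P (o4 3) -> forall i,
  P i.
Proof.
by move=> P0 P1 P2 P3 [[|[|[|[|i]]]] Hi] //; have -> : Hi = isT by apply: eq_irrelevance.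
Qed.

Lemma big_ord2 (V : Type) (idx : V) (op : Monoid.law idx) (F : 'I_2 -> V) :
  \big[op/idx]_i F i = op (F (o2 0)) (F (o2 1)).
Proof.
rewrite !big_ord_recl big_ord0 Monoid.mulm1.
by congr (op (F _) (F _)); apply: val_inj.
Qed.

Lemma big_ord4 (V : Type) (idx : V) (op : Monoid.law idx) (F : 'I_4 -> V) :
  \big[op/idx]_i F i = op (F (o4 0)) (op (F (o4 1)) (op (F (o4 2)) (F (o4 3)))).
Proof.
rewrite !big_ord_recl big_ord0 Monoid.mulm1.
by congr (op (F _) (op (F _) (op (F _) (F _)))); apply: val_inj.
Qed.

Let AB_swap t u : \sum_v A t v * B v u =
  if (t.1 == u.2) && (t.2 == u.1) then y u.1 * y u.2 else 0.
Proof.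
case: t u => [t1 t2] [u1 u2]; rewrite big_ord4 /A /B /y /=.
elim/ord2_ind: t1; elim/ord2_ind: t2; elim/ord2_ind: u1; elim/ord2_ind: u2 => /=;
  rewrite ?mul0r ?mulr0 ?mul1r ?addr0 ?add0r ?mulr1 ?expr2 ?mulN1r ?opprK ?subrr ?addNr //;
  by rewrite -mulrDl halfD mul1r.
Qed.

Let BA_diag u v : \sum_t B u t * A t v = if u == v then d v else 0.
Proof.
rewrite -(pair_bigA _ (fun t1 t2 => B u (t1, t2) * A (t1, t2) v)) /= !big_ord2 /A /B /d /=.
elim/ord4_ind: u; elim/ord4_ind: v => /=;
  rewrite ?mul0r ?mulr0 ?mul1r ?addr0 ?add0r ?mulr1 ?expr2 ?mulrN1 ?opprK ?subrr ?addNr //;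
  by rewrite -?opprD -mulrDl halfD mul1r.
Qed.

(** The coefficient of degree j in p_g(X^2, 1, X, -X) = p_(g^2)(X^2, 1): both sides
    are the trace of g on a tensor power, of the weighted exchange on the right
    and of its diagonal form on the left. *)
Lemma square_colorings n (g : 'S_n) j :
  \sum_(c : {ffun 'I_n -> 'I_4} | g \in level_stab c)
    (-1) ^+ content c (o4 3) *
      (2 * content c (o4 0) + content c (o4 2) + content c (o4 3) == j)%N%:R =
  \sum_(b : {ffun 'I_n -> 'I_2} | (g ^+ 2)%g \in level_stab b)
    (2 * content b (o2 0) == j)%N%:R :> algC.
Proof.
have := perm_traceC g A B; rewrite (eq_perm_trace _ AB_swap) (eq_perm_trace _ BA_diag).
rewrite perm_trace_swap perm_trace_diag => /(congr1 (coefp j)).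
rewrite /= !coef_sum => E;
  transitivity (\sum_(b : {ffun 'I_n -> 'I_2} | (g ^+ 2)%g \in level_stab b)
  (\prod_t y t ^+ (2 * content b t))`_j); last first.
  apply: eq_bigr => b _; rewrite big_ord2 /y /= expr1n mulr1 coefXn eq_sym.
  by case: eqP.
rewrite E; apply: eq_bigr => c _; rewrite big_ord4 /d /= expr1n mul1r [(- 'X) ^+ _]exprNn.
have sgn_front (p q r s : Q) : p * (q * (s * r)) = s * (p * (q * r)).
  by rewrite [q * _]mulrCA [LHS]mulrCA.
rewrite -exprM sgn_front -!exprD -polyC1 -polyCN -polyC_exp coefCM coefXn addnA.
by rewrite eq_sym.
Qed.

End SquareColorings.

(** * Kernels for the two components of O_4 *)

Lemma forall_ord4 (P : pred 'I_4) :
  [forall i, P i] = [&& P (o4 0), P (o4 1), P (o4 2) & P (o4 3)].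
Proof.
apply/forallP/and4P => [H | [P0 P1 P2 P3]]; first by split.
by elim/ord4_ind.
Qed.

Lemma alternating_tperm m (kappa : {ffun 'I_m -> nat} -> int) :
  (forall (eta : {ffun 'I_m -> nat}) (i j : 'I_m), i != j ->
    kappa [ffun k => eta (tperm i j k)] = - kappa eta) ->
  alternating kappa.
Proof.
move=> asym eta v; have [ts -> dp] := prod_tpermP v.
elim: ts dp eta => [|t ts IHts] /=.
  move=> _ eta; rewrite big_nil odd_perm1 mul1r; congr kappa.
  by apply/ffunP=> i; rewrite ffunE perm1.
case/andP=> dt dts eta; rewrite big_cons odd_permM odd_tperm dt signr_addb -mulrA -IHts //.
rewrite expr1 mulN1r -(asym _ t.1 t.2) //; congr kappa; apply/ffunP=> i.
by rewrite !ffunE permM.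
Qed.

(** The constant term of t^d times the sum of the two expansions of 1 / (t - 1/t),
    in powers of 1/t and in powers of t. *)
Definition odd_sign (d : int) : int := if 0 < d then (d %% 2)%Z else - (d %% 2)%Z.

Lemma odd_signN d : odd_sign (- d) = - odd_sign d.
Proof. by rewrite /odd_sign; case: (ltrP 0 (- d)); case: (ltrP 0 d); lia. Qed.

Definition parity (x : nat) : int := (-1) ^+ x.

Section Kernels.

Implicit Type eta : {ffun 'I_4 -> nat}.

Let e eta (i j : 'I_4) : int := odd_sign ((eta i)%:Z - (eta j)%:Z).
Let q eta (i j : 'I_4) : int := parity (eta j) - parity (eta i).

(** The Pfaffian of the matrix [e]: evaluated at (t, u, 1/u, 1/t), the alternant of
    exponents eta is divided by (t - 1/t) (u - 1/u), and the Pfaffian collects the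
    constant terms of the result, up to a scalar. *)
Definition kernel_SO eta : int :=
  e eta (o4 0) (o4 1) * e eta (o4 2) (o4 3)
  - e eta (o4 0) (o4 2) * e eta (o4 1) (o4 3)
  + e eta (o4 0) (o4 3) * e eta (o4 1) (o4 2).

(** The polarization of the Pfaffian between [e] and [q]: at (t, 1/t, 1, -1) the
    first two variables contribute the entries of [e] and the last two the signs
    in [q]. *)
Definition kernel_O eta : int :=
  (e eta (o4 0) (o4 1) * q eta (o4 2) (o4 3) + q eta (o4 0) (o4 1) * e eta (o4 2) (o4 3))
  - (e eta (o4 0) (o4 2) * q eta (o4 1) (o4 3) + q eta (o4 0) (o4 2) * e eta (o4 1) (o4 3))
  + (e eta (o4 0) (o4 3) * q eta (o4 1) (o4 2) + q eta (o4 0) (o4 3) * e eta (o4 1) (o4 2)).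

Let eC eta i j : e eta i j = - e eta j i.
Proof. by rewrite /e -odd_signN opprB. Qed.

Let qC eta i j : q eta i j = - q eta j i.
Proof. by rewrite /q opprB. Qed.

Lemma kernel_SO_alternating : alternating kernel_SO.
Proof.
apply: alternating_tperm => eta i j.
have E k l : e [ffun k => eta (tperm i j k)] k l = e eta (tperm i j k) (tperm i j l).
  by rewrite /e !ffunE.
rewrite /kernel_SO !E /tperm !permE /= {E}.
pose C := eC eta.
move: (C (o4 1) (o4 0)) (C (o4 2) (o4 0)) (C (o4 3) (o4 0))
  (C (o4 2) (o4 1)) (C (o4 3) (o4 1)) (C (o4 3) (o4 2)) => E10 E20 E30 E21 E31 E32.
elim/ord4_ind: i; elim/ord4_ind: j => //= _;
 rewrite ?(E10, E20, E30, E21, E31, E32); ring.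
Qed.

Lemma kernel_O_alternating : alternating kernel_O.
Proof.
apply: alternating_tperm => eta i j.
have E k l : e [ffun k => eta (tperm i j k)] k l = e eta (tperm i j k) (tperm i j l).
  by rewrite /e !ffunE.
have F k l : q [ffun k => eta (tperm i j k)] k l = q eta (tperm i j k) (tperm i j l).
  by rewrite /q !ffunE.
rewrite /kernel_O !E !F /tperm !permE /= {E F}.
pose C := eC eta; pose D := qC eta.
move: (C (o4 1) (o4 0)) (C (o4 2) (o4 0)) (C (o4 3) (o4 0))
  (C (o4 2) (o4 1)) (C (o4 3) (o4 1)) (C (o4 3) (o4 2)) => E10 E20 E30 E21 E31 E32.
move: (D (o4 1) (o4 0)) (D (o4 2) (o4 0)) (D (o4 3) (o4 0))
  (D (o4 2) (o4 1)) (D (o4 3) (o4 1)) (D (o4 3) (o4 2)) => F10 F20 F30 F21 F31 F32.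
elim/ord4_ind: i; elim/ord4_ind: j => //= _;
 rewrite ?(E10, E20, E30, E21, E31, E32, F10, F20, F30, F21, F31, F32); ring.
Qed.

Lemma odd_sign_gt (x y : nat) : (y < x)%N -> odd_sign (x%:Z - y%:Z) = (odd x (+) odd y)%:R.
Proof.
move=> lt_yx; rewrite /odd_sign subr_gt0 ltz_nat lt_yx.
by case Ex: (odd x); case Ey: (odd y); rewrite /=; lia.
Qed.

Lemma kernel_SO_part n (a : intpart n) : (size a <= 4)%N ->
  kernel_SO (addstair (part_fun 4 a)) = 2 * ((a \in E4 n) || (a \in O4 n))%:R.
Proof.
move=> size_a; have dec i j lt_ij := odd_sign_gt (@addstair_decr n 4 a i j lt_ij).
rewrite /kernel_SO /e !dec // !inE size_a /=.
rewrite !forall_ord4 !ffunE !oddD /=.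
by do 4!case: (odd _).
Qed.

Lemma kernel_O_part n (a : intpart n) : (size a <= 4)%N ->
  kernel_O (addstair (part_fun 4 a)) = 4 * sgn4 a.
Proof.
move=> size_a; have dec i j lt_ij := odd_sign_gt (@addstair_decr n 4 a i j lt_ij).
rewrite /kernel_O /e !dec // /sgn4 !inE size_a /=.
rewrite !forall_ord4 /q /parity -![(-1) ^+ addstair _ _]signr_odd !ffunE !oddD /=.
by do 4!case: (odd _).
Qed.

End Kernels.

(** * Sums of the kernels over colorings *)

Definition two_color_sum n (h : 'S_n) (F : int -> int) :=
  \sum_(b : {ffun 'I_n -> 'I_2} | h \in level_stab b)
     F ((content b (o2 0))%:Z - (content b (o2 1))%:Z).

Section ColoringSums.

Variables (n : nat) (g : 'S_n).

Definition four_color_sum (Phi : nat -> nat -> nat -> nat -> int) :=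
  \sum_(c : {ffun 'I_n -> 'I_4} | g \in level_stab c)
    Phi (content c (o4 0)) (content c (o4 1)) (content c (o4 2)) (content c (o4 3)).

Lemma sum_recolor4 (i j k l : 'I_4) (Phi : nat -> nat -> nat -> nat -> int) :
  uniq [:: i; j; k; l] ->
  \sum_(c : {ffun 'I_n -> 'I_4} | g \in level_stab c)
    Phi (content c i) (content c j) (content c k) (content c l) = four_color_sum Phi.
Proof.
move=> uniq_s; pose s := [:: i; j; k; l].
have inj : injective (fun x : 'I_4 => nth i s x).
  by move=> x y /eqP; rewrite nth_uniq // => /eqP /val_inj.
rewrite /four_color_sum -(recolor_sum g (perm inj)
  (fun mu => Phi (mu (o4 0)) (mu (o4 1)) (mu (o4 2)) (mu (o4 3)))).
apply: eq_bigr => c _.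
have E x : [ffun i => content c (perm inj i)] x =
  content c (nth i s x) by rewrite [LHS]ffunE permE.
by rewrite !E.
Qed.

Definition indic (b : bool) : int := b%:R.

(** The coefficient of t^d in 2 - t^2 - t^-2 = - (t - 1/t)^2, which is twice the
    density of the Weyl integration formula of SL_2. *)
Definition second_diff (d : int) : int :=
  2 * indic (d == 0) - indic (d == 2) - indic (d == -2).

Lemma second_diff_large d : 2 < `|d| -> second_diff d = 0.
Proof.
rewrite /second_diff /indic => large.
by case: (d =P 0); case: (d =P 2); case: (d =P -2); lia.
Qed.

(** The symmetrization in d of odd_sign (d + j) is a difference of two values at
    distance 2 j of a function with period 2 on each side of 0, so it has finite
    support. *)
Lemma odd_sign_diff1 d : odd_sign (d + 1) + odd_sign (- d + 1) = 2 * indic (d == 0).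
Proof.
rewrite /odd_sign /indic; case: (ltrP 0 (d + 1)); case: (ltrP 0 (- d + 1));
  case: (d =P 0) => ? ? ?; rewrite /=; lia.
Qed.

Lemma odd_sign_diff2 d : odd_sign (d + 2) + odd_sign (- d + 2) =
  2 * (indic (d == 1) + indic (d == -1)).
Proof.
rewrite /odd_sign /indic; case: (ltrP 0 (d + 2)); case: (ltrP 0 (- d + 2));
  case: (d =P 1) => ?; case: (d =P -1) => ? ? ?; rewrite /=; lia.
Qed.

Lemma odd_sign_diff3 d :
  odd_sign (d + 3) + odd_sign (- d + 3) =
    2 * (indic (d == 0) + indic (d == 2) + indic (d == -2)).
Proof.
rewrite /odd_sign /indic; case: (ltrP 0 (d + 3)); case: (ltrP 0 (- d + 3));
  case: (d =P 0) => ?; case: (d =P 2) => ?; case: (d =P -2) => ? ? ?; rewrite /=; lia.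
Qed.

(** By permutations of the colors, the sums to be computed depend on the content
    only through the two differences that are the exponents of t and u at
    (t, u, 1/u, 1/t); they are invariant under sign changes and exchange of the
    differences. *)
Definition diff_sum (F : int -> int -> int) :=
  four_color_sum (fun a b c d => F (a%:Z - d%:Z) (b%:Z - c%:Z)).

Lemma diff_sum_flip1 F : diff_sum (fun x y => F (- x) y) = diff_sum F.
Proof.
rewrite /diff_sum -[RHS](@sum_recolor4 (o4 3) (o4 1) (o4 2) (o4 0)) //.
by apply: eq_bigr => c _; rewrite opprB.
Qed.

Lemma diff_sum_flip2 F : diff_sum (fun x y => F x (- y)) = diff_sum F.
Proof.
rewrite /diff_sum -[RHS](@sum_recolor4 (o4 0) (o4 2) (o4 1) (o4 3)) //.
by apply: eq_bigr => c _; rewrite opprB.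
Qed.

Lemma diff_sum_swap F : diff_sum (fun x y => F y x) = diff_sum F.
Proof. by rewrite /diff_sum -[RHS](@sum_recolor4 (o4 1) (o4 0) (o4 3) (o4 2)). Qed.

Lemma diff_sumD F G : diff_sum (fun x y => F x y + G x y) = diff_sum F + diff_sum G.
Proof. exact: big_split. Qed.

Lemma eq_diff_sum F G : (forall x y, F x y = G x y) -> diff_sum F = diff_sum G.
Proof. by move=> E; apply: eq_bigr => c _; apply: E. Qed.

Definition diff_kernel (x y : int) := odd_sign (x + 1) * odd_sign (- y + 1)
  - odd_sign (x + 2) * odd_sign (y + 2) + odd_sign (x + 3) * odd_sign (y + 1).

(** The eight symmetries of the pair (x, y) turn the shifted sign functions into
    finitely supported ones, and the sum factors in the variables x + y and x - y:
    this is the isogeny from SL_2 x SL_2 to SO_4. *)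
Lemma symmetrized_kernel x y :
  (diff_kernel x y + diff_kernel (- x) y + (diff_kernel x (- y) + diff_kernel (- x) (- y)))
  + (diff_kernel y x + diff_kernel (- y) x + (diff_kernel y (- x) + diff_kernel (- y) (- x)))
  = 4 * (second_diff (x + y) * second_diff (x - y)).
Proof.
transitivity (
  2 * (2 * indic (x == 0)) * (2 * indic (y == 0))
  - 2 * (2 * (indic (x == 1) + indic (x == -1))) * (2 * (indic (y == 1) + indic (y == -1)))
  + (2 * (indic (x == 0) + indic (x == 2) + indic (x == -2))) * (2 * indic (y == 0))
  + (2 * indic (x == 0)) * (2 * (indic (y == 0) + indic (y == 2) + indic (y == -2)))).
  rewrite -!odd_sign_diff1 -!odd_sign_diff2 -!odd_sign_diff3 /diff_kernel !opprK; ring.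
(* Away from small x and y one of the factors on the right vanishes, so only
   finitely many values remain to be compared. *)
have big_xy : 2 < `|x| \/ 2 < `|y| -> second_diff (x + y) * second_diff (x - y) = 0.
  move=> big; have [ge|le] := ltrP 2 `|x + y|.
    by rewrite second_diff_large ?mul0r.
  by rewrite [X in _ * X]second_diff_large ?mulr0 //; lia.
case: x big_xy => [[|[|[|x]]]|[|[|x]]]; case: y => [[|[|[|y]]]|[|[|y]]] big_xy;
  first [by [] | rewrite big_xy //; lia].
Qed.

Lemma sum_kernel_SO :
  \sum_(c : {ffun 'I_n -> 'I_4} | g \in level_stab c) kernel_SO (addstair (content c)) =
    diff_sum diff_kernel.
Proof.
pose T1 := fun a b c d : nat => odd_sign (a%:Z - b%:Z + 1) * odd_sign (c%:Z - d%:Z + 1).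
pose T2 := fun a b c d : nat => odd_sign (a%:Z - b%:Z + 2) * odd_sign (c%:Z - d%:Z + 2).
pose T3 := fun a b c d : nat => odd_sign (a%:Z - b%:Z + 3) * odd_sign (c%:Z - d%:Z + 1).
transitivity (four_color_sum T1 - four_color_sum T2 + four_color_sum T3).
  rewrite -(@sum_recolor4 (o4 0) (o4 2) (o4 1) (o4 3) T2) //.
  rewrite -(@sum_recolor4 (o4 0) (o4 3) (o4 1) (o4 2) T3) //.
  rewrite -sumrB -big_split; apply: eq_bigr => c _; rewrite /kernel_SO /T1 /T2 /T3 /addstair.
  have E i : addstair (content c) i = (content c i + stair i)%N by rewrite [LHS]ffunE.
  rewrite !E /=; congr (odd_sign _ * odd_sign _ - odd_sign _ * odd_sign _ + odd_sign _ *
    odd_sign _);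
    rewrite /stair /=; lia.
rewrite -(@sum_recolor4 (o4 0) (o4 3) (o4 2) (o4 1) T1) //.
rewrite -(@sum_recolor4 (o4 0) (o4 3) (o4 1) (o4 2) T2) //.
rewrite -(@sum_recolor4 (o4 0) (o4 3) (o4 1) (o4 2) T3) //.
by rewrite -sumrB -big_split; apply: eq_bigr => c _; rewrite /diff_kernel opprB.
Qed.

(** The color 2 i + j stands for the pair of colors (i, j), so that the sum and the
    difference of the two color differences are those of the components. *)
Lemma sum_pair_coloring (F : int -> int) :
  diff_sum (fun x y => F (x + y) * F (x - y)) = two_color_sum g F ^+ 2.
Proof.
have lt4 (i j : 'I_2) : (2 * i + j < 4)%N by have := ltn_ord i; have := ltn_ord j; lia.
pose q i j := Ordinal (lt4 i j).
have q_inj i j i' j' : q i j = q i' j' -> i = i' /\ j = j'.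
  move/(congr1 val) => /= E; have := ltn_ord j; have := ltn_ord j'.
  by move=> ? ?; split; apply: val_inj => /=; lia.
pose p1 (c : 'I_4) : 'I_2 := inord (c %/ 2); pose p2 (c : 'I_4) : 'I_2 := inord (c %% 2).
have qK i j : (p1 (q i j) = i) * (p2 (q i j) = j).
  by elim/ord2_ind: i; elim/ord2_ind: j; split; apply: val_inj; rewrite /= inordK.
have pK c : q (p1 c) (p2 c) = c.
  by apply: val_inj; elim/ord4_ind: c; rewrite /= !inordK.
pose f (b : {ffun 'I_n -> 'I_2} * {ffun 'I_n -> 'I_2}) := [ffun x => q (b.1 x) (b.2 x)].
have f_bij : bijective f.
  exists (fun c : {ffun 'I_n -> 'I_4} => ([ffun x => p1 (c x)], [ffun x => p2 (c x)])) =>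
    [[b1 b2]|c].
    by congr (_, _); apply/ffunP=> x; rewrite !ffunE qK.
  by apply/ffunP=> x; rewrite !ffunE pK.
rewrite expr2 big_distrlr pair_big /= /diff_sum /four_color_sum (reindex f) /=;
  last exact: onW_bij.
apply: eq_big => [[b1 b2] | [b1 b2] _] /=.
  apply/mem_level_stab/andP => [E | [/mem_level_stab E1 /mem_level_stab E2] x].
    by split; apply/mem_level_stab=> x; have := E x; rewrite !ffunE => /q_inj[].
  by rewrite !ffunE /= E1 E2.
have cntE i j : content (f (b1, b2)) (q i j) = #|[pred x | (b1 x == i) && (b2 x == j)]|.
  rewrite ffunE; apply: eq_card => x; rewrite !inE ffunE /=.
  by apply/eqP/andP => [/q_inj[-> ->] | [/eqP-> /eqP->]].
have sum1 i : content b1 i =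
  (content (f (b1, b2)) (q i (o2 0)) + content (f (b1, b2)) (q i (o2 1)))%N.
  rewrite !cntE [LHS]ffunE -sum1_card (partition_big b2 xpredT) //= big_ord2 -!sum1_card.
  by congr addn; apply: eq_bigl => x; rewrite !inE.
have sum2 j : content b2 j =
  (content (f (b1, b2)) (q (o2 0) j) + content (f (b1, b2)) (q (o2 1) j))%N.
  rewrite !cntE [LHS]ffunE -sum1_card (partition_big b1 xpredT) //= big_ord2 -!sum1_card.
  by congr addn; apply: eq_bigl => x; rewrite !inE andbC.
have q00 : q (o2 0) (o2 0) = o4 0 by apply: val_inj.
have q01 : q (o2 0) (o2 1) = o4 1 by apply: val_inj.
have q10 : q (o2 1) (o2 0) = o4 2 by apply: val_inj.
have q11 : q (o2 1) (o2 1) = o4 3 by apply: val_inj.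
rewrite !sum1 !sum2 q00 q01 q10 q11.
move: (content _ (o4 0)) (content _ (o4 1)) (content _ (o4 2)) (content _ (o4 3)) => u v w z.
by congr (F _ * F _); lia.
Qed.

Lemma sum_kernel_SO_square :
  \sum_(c : {ffun 'I_n -> 'I_4} | g \in level_stab c) 2 * kernel_SO (addstair (content c))
    = two_color_sum g second_diff ^+ 2.
Proof.
rewrite -big_distrr /= sum_kernel_SO -sum_pair_coloring.
have E8 (F : int -> int -> int) : diff_sum (fun x y =>
    (F x y + F (- x) y + (F x (- y) + F (- x) (- y)))
    + (F y x + F (- y) x + (F y (- x) + F (- y) (- x)))) = 8 * diff_sum F.
  rewrite !diff_sumD (diff_sum_flip1 F) (diff_sum_flip2 F).
  rewrite (diff_sum_flip1 (fun x y => F x (- y))) (diff_sum_flip2 F).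
  rewrite (diff_sum_swap F) (diff_sum_swap (fun x y => F (- x) y)) (diff_sum_flip1 F).
  rewrite (diff_sum_swap (fun x y => F x (- y))) (diff_sum_flip2 F).
  rewrite (diff_sum_swap (fun x y => F (- x) (- y))) (diff_sum_flip1 (fun x y => F x (- y)))
    (diff_sum_flip2 F).
  by ring.
have : 8 * diff_sum diff_kernel =
  4 * diff_sum (fun x y => second_diff (x + y) * second_diff (x - y)).
  rewrite -E8 (eq_diff_sum symmetrized_kernel) /diff_sum /four_color_sum big_distrr /=.
  by apply: eq_bigr.
move: (diff_sum diff_kernel) (diff_sum _) => u v E; lia.
Qed.

(** The analogue of [diff_sum] at (t, 1/t, 1, -1): the difference of the first two
    multiplicities is the exponent of t and the last one counts signs. *)
Definition signed_diff_sum (H : int -> int) :=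
  four_color_sum (fun a b c d => H (a%:Z - b%:Z) * parity d).

Lemma signed_diff_sum_flip H : signed_diff_sum (fun d => H (- d)) = signed_diff_sum H.
Proof.
rewrite /signed_diff_sum -[RHS](@sum_recolor4 (o4 1) (o4 0) (o4 2) (o4 3)) //.
by apply: eq_bigr => c _; rewrite opprB.
Qed.

Lemma signed_diff_sum_recolor (i j k l : 'I_4) H : uniq [:: i; j; k; l] ->
  \sum_(c : {ffun 'I_n -> 'I_4} | g \in level_stab c)
    H ((content c i)%:Z - (content c j)%:Z) * parity (content c l) = signed_diff_sum H.
Proof. exact: (@sum_recolor4 i j k l (fun a b c d => H (a%:Z - b%:Z) * parity d)). Qed.

Lemma sum_kernel_O :
  \sum_(c : {ffun 'I_n -> 'I_4} | g \in level_stab c) kernel_O (addstair (content c))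
   = 2 * signed_diff_sum second_diff.
Proof.
(* Each term of the kernel splits in two by the definition of q; permuting colors
   brings the twelve halves to the form of [signed_diff_sum]. *)
pose H1 d := odd_sign (d + 1); pose H2 d := odd_sign (d + 2); pose H3 d := odd_sign (d + 3).
transitivity (6 * signed_diff_sum H1 - 2 * signed_diff_sum H3).
  transitivity ((signed_diff_sum H1 + signed_diff_sum H1) +
    (signed_diff_sum H1 + signed_diff_sum H1) -
      ((signed_diff_sum H2 - signed_diff_sum H2) + (signed_diff_sum H2 - signed_diff_sum H2))
     + (- (signed_diff_sum H3 + signed_diff_sum H3) +
       (signed_diff_sum H1 + signed_diff_sum H1))); last by ring.
  rewrite -{1}(@signed_diff_sum_recolor (o4 0) (o4 1) (o4 2) (o4 3) H1) //.
  rewrite -{1}(@signed_diff_sum_recolor (o4 0) (o4 1) (o4 3) (o4 2) H1) //.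
  rewrite -{1}(@signed_diff_sum_recolor (o4 2) (o4 3) (o4 0) (o4 1) H1) //.
  rewrite -{1}(@signed_diff_sum_recolor (o4 2) (o4 3) (o4 1) (o4 0) H1) //.
  rewrite -{1}(@signed_diff_sum_recolor (o4 1) (o4 2) (o4 0) (o4 3) H1) //.
  rewrite -{1}(@signed_diff_sum_recolor (o4 1) (o4 2) (o4 3) (o4 0) H1) //.
  rewrite -{1}(@signed_diff_sum_recolor (o4 0) (o4 2) (o4 1) (o4 3) H2) //.
  rewrite -{1}(@signed_diff_sum_recolor (o4 0) (o4 2) (o4 3) (o4 1) H2) //.
  rewrite -{1}(@signed_diff_sum_recolor (o4 1) (o4 3) (o4 2) (o4 0) H2) //.
  rewrite -{1}(@signed_diff_sum_recolor (o4 1) (o4 3) (o4 0) (o4 2) H2) //.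
  rewrite -{1}(@signed_diff_sum_recolor (o4 0) (o4 3) (o4 2) (o4 1) H3) //.
  rewrite -{1}(@signed_diff_sum_recolor (o4 0) (o4 3) (o4 1) (o4 2) H3) //.
  rewrite -!big_split -!sumrN -!big_split -!sumrN -!big_split; apply: eq_bigr => c _.
  have E i : addstair (content c) i = (content c i + stair i)%N by rewrite [LHS]ffunE.
  rewrite /kernel_O !E /parity !exprD /= /stair /=.
  move: (content c _) (content c _) (content c _) (content c _) => w x y z.
  have E1 (u v p r : nat) : (u + p)%N%:Z - (v + r)%N%:Z = u%:Z - v%:Z + (p%:Z - r%:Z) by lia.
  rewrite !E1 /H1 /H2 /H3.
  have -> : (4 - 1)%N%:Z - (4 - 2)%N%:Z = 1 by [].
  have -> : (4 - 3)%N%:Z - (4 - 4)%N%:Z = 1 by [].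
  have -> : (4 - 2)%N%:Z - (4 - 3)%N%:Z = 1 by [].
  have -> : (4 - 1)%N%:Z - (4 - 3)%N%:Z = 2 by [].
  have -> : (4 - 2)%N%:Z - (4 - 4)%N%:Z = 2 by [].
  have -> : (4 - 1)%N%:Z - (4 - 4)%N%:Z = 3 by [].
  have -> : (-1) ^+ (4 - 1) = -1 :> int by [].
  have -> : (-1) ^+ (4 - 2) = 1 :> int by [].
  have -> : (-1) ^+ (4 - 3) = -1 :> int by [].
  have -> : (-1) ^+ (4 - 4) = 1 :> int by [].
  by ring.
have sumP_D F F' : signed_diff_sum (fun d => F d + F' d) =
  signed_diff_sum F + signed_diff_sum F'.
  by rewrite /signed_diff_sum /four_color_sum -big_split; apply: eq_bigr => c _;
    rewrite mulrDl.
have sumP_Z a F : signed_diff_sum (fun d => a * F d) = a * signed_diff_sum F.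
  by rewrite /signed_diff_sum /four_color_sum big_distrr; apply: eq_bigr => c _;
    rewrite /= mulrA.
have sumP_ext F F' : (forall d, F d = F' d) -> signed_diff_sum F = signed_diff_sum F'.
  by move=> EF; apply: eq_bigr => c _; rewrite EF.
have E1 : signed_diff_sum H1 + signed_diff_sum H1 =
  2 * signed_diff_sum (fun d => indic (d == 0)).
  rewrite -{2}signed_diff_sum_flip -sumP_D -sumP_Z; apply: sumP_ext => d;
    exact: odd_sign_diff1.
have E3 : signed_diff_sum H3 + signed_diff_sum H3 =
  2 * signed_diff_sum (fun d => indic (d == 0) + indic (d == 2) + indic (d == -2)).
  rewrite -{2}signed_diff_sum_flip -sumP_D -sumP_Z; apply: sumP_ext => d;
    exact: odd_sign_diff3.
have -> : signed_diff_sum second_diff = 3 * signed_diff_sum (fun d => indic (d == 0))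
    + (-1) * signed_diff_sum (fun d => indic (d == 0) + indic (d == 2) + indic (d == -2)).
  by rewrite -!sumP_Z -sumP_D; apply: sumP_ext => d; rewrite /second_diff; ring.
move: E1 E3; move: (signed_diff_sum _) (signed_diff_sum _) (signed_diff_sum _)
  (signed_diff_sum _) => u v w z E1 E3; lia.
Qed.

(** As the multiplicities add up to 2 k, the difference of the first two being d
    amounts to the exponent of X in p_g(X^2, 1, X, -X) being 2 k + d. *)
Lemma sum_signed_square k : n = (2 * k)%N -> (0 < k)%N ->
  signed_diff_sum second_diff = two_color_sum (g ^+ 2)%g second_diff.
Proof.
move=> n2k k_gt0; pose P4 j : int := \sum_(c : {ffun 'I_n -> 'I_4} | g \in level_stab c)
    parity (content c (o4 3)) *
      indic (2 * content c (o4 0) + content c (o4 2) + content c (o4 3) == j)%N.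
pose P2 j : int := \sum_(b : {ffun 'I_n -> 'I_2} | (g ^+ 2)%g \in level_stab b)
    indic (2 * content b (o2 0) == j)%N.
have P42 j : P4 j = P2 j.
  apply: (@intr_inj algC); have := square_colorings g j; rewrite /P4 /P2 !rmorph_sum /=.
  have -> : \sum_(b : {ffun 'I_n -> 'I_2} | (g ^+ 2)%g \in level_stab b)
    (indic (2 * content b (o2 0) == j)%N)%:~R
     = \sum_(b : {ffun 'I_n -> 'I_2} | (g ^+ 2)%g \in level_stab b)
       (2 * content b (o2 0) == j)%N%:R :> algC.
    by apply: eq_bigr => b _; rewrite /indic; case: eqP.
  move=> <-; apply: eq_bigr => c _; rewrite rmorphM /= /parity rmorph_sign /indic.
  by case: eqP.
have ind_eq (b b' : bool) : b = b' -> indic b = indic b' by move=> ->.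
transitivity (2 * P4 (2 * k)%N - P4 (2 * k + 2)%N - P4 (2 * k - 2)%N).
  rewrite /P4 big_distrr -!sumrB; apply: eq_bigr => c _ /=.
  have := sum_content c; rewrite big_ord4 /= /second_diff.
  move: (content c (o4 0)) (content c (o4 1)) (content c (o4 2)) (content c (o4 3)) =>
    u v w z sum_c.
  rewrite (ind_eq (u%:Z - v%:Z == 0) (2 * u + w + z == 2 * k)%N); last by apply/eqP/eqP; lia.
  rewrite (ind_eq (u%:Z - v%:Z == 2) (2 * u + w + z == 2 * k + 2)%N); last by apply/eqP/eqP;
    lia.
  rewrite (ind_eq (u%:Z - v%:Z == -2) (2 * u + w + z == 2 * k - 2)%N); last by apply/eqP/eqP;
    lia.
  by ring.
rewrite !P42 /P2 big_distrr -!sumrB; apply: eq_bigr => b _ /=.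
have := sum_content b; rewrite big_ord2 /= /second_diff.
move: (content b (o2 0)) (content b (o2 1)) => u v sum_b.
rewrite (ind_eq (u%:Z - v%:Z == 0) (2 * u == 2 * k)%N); last by apply/eqP/eqP; lia.
rewrite (ind_eq (u%:Z - v%:Z == 2) (2 * u == 2 * k + 2)%N); last by apply/eqP/eqP; lia.
by rewrite (ind_eq (u%:Z - v%:Z == -2) (2 * u == 2 * k - 2)%N); last by apply/eqP/eqP; lia.
Qed.

End ColoringSums.

(** * The character of the partition with two equal parts *)

Lemma det2 (R : comNzRingType) (M : 'M[R]_2) :
  \det M = M (o2 0) (o2 0) * M (o2 1) (o2 1) - M (o2 0) (o2 1) * M (o2 1) (o2 0).
Proof.
rewrite (expand_det_row _ (o2 0)) big_ord2 /cofactor !det_mx11 !mxE /= addn0 expr0 expr1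
  mul1r mulN1r mulrN.
by congr (_ * M _ _ - _ * M _ _); apply: val_inj.
Qed.

Lemma E4_notin_O4 n (a : intpart n) : a \in E4 n -> (a \in O4 n) = false.
Proof.
rewrite !inE => /andP[_ /forallP/(_ (o4 0)) ev]; apply/negP=> /andP[_ /forallP/(_ (o4 0))].
by rewrite (negPf ev).
Qed.

Section TwoRows.

Variables (k : nat) (k_gt0 : (0 < k)%N).
Local Notation n := (2 * k)%N.
Local Notation chi := (irr_sym (two_equal_parts k_gt0)).

(** The determinant of size 2 is h_k h_k - h_(k+1) h_(k-1), and the content of a
    2-coloring is determined by its first entry. *)
Lemma two_row_values (h : 'S_n) :
  chi h = (\sum_(b : {ffun 'I_n -> 'I_2} | h \in level_stab b)
     ((content b (o2 0) == k)%:R - (content b (o2 0) == k.+1)%:R))%:~R.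
Proof.
rewrite (@irr_sym_jt _ 2) // color_cfE !rmorph_sum; apply: eq_bigr => b _ /=.
congr _%:~R; rewrite /acoef det2 !mxE.
have E0 : addstair (part_fun 2 (two_equal_parts k_gt0)) (o2 0) =
  k.+1 by rewrite !ffunE /= addn1.
have E1 : addstair (part_fun 2 (two_equal_parts k_gt0)) (o2 1) = k by rewrite !ffunE /= addn0.
rewrite E0 E1 /stair; have := sum_content b; rewrite big_ord2 /=.
move: (content b (o2 0)) (content b (o2 1)) => u v sum_uv.
have -> : (k.+1 == u + (2 - 1))%N = (u == k) by lia.
have -> : (k == v + (2 - 2))%N = (u == k) by lia.
have -> : (k.+1 == u + (2 - 2))%N = (u == k.+1) by lia.
have -> : (k == v + (2 - 1))%N = (u == k.+1) by lia.
by case: eqP; case: eqP.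
Qed.

(** Exchanging the two colors exchanges the cases d = 2 and d = -2. *)
Lemma two_row_second_diff (h : 'S_n) : 2 * chi h = (two_color_sum h second_diff)%:~R.
Proof.
rewrite two_row_values -(intrM _ 2); congr _%:~R; rewrite /two_color_sum big_distrr /=.
pose N (i : 'I_2) := \sum_(b : {ffun 'I_n -> 'I_2} | h \in level_stab b)
  (content b i == k.+1)%:R : int.
have N01 : N (o2 1) = N (o2 0).
  rewrite /N -[RHS](recolor_sum h (tperm (o2 0) (o2 1)) (fun mu => (mu (o2 0) == k.+1)%:R)).
  by apply: eq_bigr => b _; rewrite [X in _ = (X == _)%:R]ffunE tpermL.
pose N0 := \sum_(b : {ffun 'I_n -> 'I_2} | h \in level_stab b) (content b (o2 0) == k)%:R :
  int.
transitivity (2 * N0 - N (o2 0) - N (o2 1)).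
  rewrite N01 -[LHS]big_distrr /= sumrB -/N0 -/(N _); ring.
rewrite /N0 /N big_distrr -!sumrB; apply: eq_bigr => b _ /=; rewrite /second_diff.
have := sum_content b; rewrite big_ord2 /=.
move: (content b (o2 0)) (content b (o2 1)) => u v sum_uv.
have -> : (u%:Z - v%:Z == 0) = (u == k) by apply/eqP/eqP; lia.
have -> : (u%:Z - v%:Z == 2) = (u == k.+1) by apply/eqP/eqP; lia.
by have -> : (u%:Z - v%:Z == -2) = (v == k.+1) by apply/eqP/eqP; lia.
Qed.

Lemma sum_indicator4 (A : {set intpart n}) (F : intpart n -> algC) :
  (forall a, a \in A -> (size a <= 4)%N) ->
  \sum_(a in A) F a = \sum_(a : intpart n | (size a <= 4)%N) (a \in A)%:R * F a.
Proof.
move=> sA; rewrite big_mkcond [RHS]big_mkcond; apply: eq_bigr => a _ /=.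
case: ifP => [Aa | nAa]; first by rewrite sA // mul1r.
by rewrite mul0r if_same.
Qed.

Let E4_indicator (F : intpart n -> algC) :
  \sum_(a in E4 n) F a = \sum_(a : intpart n | (size a <= 4)%N) (a \in E4 n)%:R * F a.
Proof. by apply: sum_indicator4 => a; rewrite inE => /andP[]. Qed.

Let O4_indicator (F : intpart n -> algC) :
  \sum_(a in O4 n) F a = \sum_(a : intpart n | (size a <= 4)%N) (a \in O4 n)%:R * F a.
Proof. by apply: sum_indicator4 => a; rewrite inE => /andP[]. Qed.

Lemma sum_SO_characters (g : 'S_n) :
  \sum_(a in E4 n) irr_sym a g + \sum_(a in O4 n) irr_sym a g = chi g ^+ 2.
Proof.
apply: (@mulfI _ (2 * 2)); first by rewrite mulf_neq0 ?pnatr_eq0.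
rewrite [RHS](_ : _ = (2 * chi g) ^+ 2); last by rewrite exprMn expr2.
rewrite two_row_second_diff -rmorphXn /= -sum_kernel_SO_square -big_distrr /= rmorphM /=.
rewrite alternant_expansion; last exact: kernel_SO_alternating.
rewrite E4_indicator O4_indicator -big_split !big_distrr /=; apply: eq_bigr => a sa.
rewrite kernel_SO_part // rmorphM /=.
have intb (b : bool) : (b%:R : int)%:~R = b%:R :> algC by case: b.
rewrite intb; case E: (a \in E4 n); first by rewrite (E4_notin_O4 E) /=; ring.
by rewrite /= mul0r add0r; ring.
Qed.

Lemma sum_O_characters (g : 'S_n) :
  \sum_(a in E4 n) irr_sym a g - \sum_(a in O4 n) irr_sym a g = chi (g ^+ 2)%g.
Proof.
apply: (@mulfI _ 4); first by rewrite pnatr_eq0.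
rewrite [RHS](_ : _ = 2 * (2 * chi (g ^+ 2)%g)); last by rewrite mulrA -natrM.
rewrite two_row_second_diff -(sum_signed_square g erefl k_gt0).
rewrite -(intrM _ 2) -sum_kernel_O.
rewrite alternant_expansion; last exact: kernel_O_alternating.
rewrite E4_indicator O4_indicator -sumrB !big_distrr /=; apply: eq_bigr => a sa.
rewrite kernel_O_part // rmorphM /= -mulrA; congr (_ * _); rewrite -mulrBl; congr (_ * _).
rewrite /sgn4; case E: (a \in E4 n); first by rewrite (E4_notin_O4 E) subr0.
by case: (a \in O4 n); rewrite ?subr0 ?sub0r ?rmorphN.
Qed.

Lemma two_row_degree : chi 1%g = 'C(n, k)%:R / k.+1%:R.
Proof.
have card_row0 j : #|[set b : {ffun 'I_n -> 'I_2} | content b (o2 0) == j]| = 'C(n, j).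
  rewrite -[n in 'C(n, _)]card_ord -card_draws.
  pose f (S : {set 'I_n}) : {ffun 'I_n -> 'I_2} := [ffun x => if x \in S then o2 0 else o2 1].
  have f_inj : injective f.
    move=> S S' /ffunP E; apply/setP=> x; have := E x; rewrite !ffunE.
    by case: (x \in S); case: (x \in S').
  rewrite -(card_imset _ f_inj); apply: eq_card => b; rewrite !inE.
  have cntf S : content (f S) (o2 0) = #|S|.
    by rewrite ffunE; apply: eq_card => x; rewrite !inE ffunE; case: (x \in S).
  apply/eqP/imsetP => [cb | [S]]; last by rewrite inE => /eqP <- ->.
  have Eb : b = f [set x | b x == o2 0].
    by apply/ffunP=> x; rewrite ffunE inE; elim/ord2_ind: (b x).
  by exists [set x | b x == o2 0]; rewrite // inE -cntf -Eb cb.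
have sum_card j : \sum_(b : {ffun 'I_n -> 'I_2} | 1%g \in level_stab b)
  (content b (o2 0) == j)%:R
    = 'C(n, j)%:R :> algC.
  rewrite -card_row0 -sum1_card natr_sum big_mkcond [RHS]big_mkcond; apply: eq_bigr => b _.
  by rewrite (group1 (level_stab_group b)) inE; case: eqP.
rewrite two_row_values rmorph_sum /=.
under eq_bigr => b _ do rewrite rmorphB !rmorph_nat.
rewrite sumrB !sum_card; apply: (canRL (mulfK _)); first by rewrite pnatr_eq0.
rewrite mulrBl -!natrM; have := mul_bin_left n k; rewrite mulnC => ->.
have -> : (n - k = k)%N by lia.
by rewrite mulnS natrD [(k * _)%N]mulnC addrK.
Qed.

End TwoRows.

Theorem theoremB (k : nat) (k_gt0 : (0 < k)%N) :
  [/\ cfSym2 (irr_sym (two_equal_parts k_gt0))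
        = \sum_(a in E4 (2 * k)%N) irr_sym a,
      cfAlt2 (irr_sym (two_equal_parts k_gt0))
        = \sum_(a in O4 (2 * k)%N) irr_sym a
    & 'C((2 * k)%N, k)%:R / (k.+1)%:R
        = \sum_(a : intpart (2 * k)%N) (sgn4 a)%:~R * deg_sym a :> algC].
Proof.
have half_double (x : algC) : 2%:R^-1 * (x + x) = x.
  by rewrite -mulr2n -(mulr_natl x) mulKf ?pnatr_eq0.
split.
- apply/cfunP=> g; rewrite cfSym2E ?inE // sum_cfunE -sum_SO_characters -sum_O_characters.
  by rewrite addrACA subrr addr0 half_double.
- apply/cfunP=> g; rewrite cfAlt2E ?inE // sum_cfunE -sum_SO_characters -sum_O_characters.
  by rewrite opprB addrC addrA subrK half_double.
rewrite -(two_row_degree k_gt0) -[X in irr_sym _ X = _](expg1n _ 2) -sum_O_characters.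
rewrite big_mkcond [X in _ - X]big_mkcond -sumrB; apply: eq_bigr => a _;
  rewrite /sgn4 /deg_sym /=.
case E: (a \in E4 _); first by rewrite (E4_notin_O4 E) subr0 mul1r.
by case: (a \in O4 _); rewrite ?subr0 ?sub0r ?rmorphN ?mul0r ?mulN1r.
Qed.
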